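(* Let $\gamma\ge0$ and $\alpha_i,\beta_i\ge0$ with $\gamma+\sum_i\alpha_i+\sum_i\beta_i=1$. Let $N_i(\pi)$ be the number of $i$-cycles of a permutation $\pi$. (1) If $E_{n,(\vec{\alpha},\vec{\beta},\gamma)}$ denotes expectation after an $(\vec{\alpha},\vec{\beta},\gamma)$ shuffle of an $n$-card deck, then as formal power series \[ \sum_{n \geq 0} u^n E_{n,(\vec{\alpha},\vec{\beta},\gamma)}\Big(\prod_i x_i^{N_i}\Big) = \prod_{i,j\ge1} \exp\Big(\frac{(u^ix_i)^j}{ij} \sum_{d|i}\mu(d)\, \tilde{p}_{jd}(\vec{\alpha},\vec{\beta},\gamma)^{i/d}\Big).\] (2) If $E'_{n,(\vec{\alpha},\vec{\beta},\gamma)}$ denotes expectation after an $(\vec{\alpha},\vec{\beta},\gamma)$ shuffle of an $n$-card deck followed by reversing the order of the cards, then \[ \sum_{n \geq 0} u^n E'_{n,(\vec{\alpha},\vec{\beta},\gamma)}\Big(\prod_i x_i^{N_i}\Big) = \sum_{n \geq 0} u^n E_{n,(\vec{\beta},\vec{\alpha},\gamma)}\Big(\prod_i x_i^{N_i}\Big).\]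
   Context: An $(\vec{\alpha},\vec{\beta},\gamma)$ shuffle of $n$ cards is the random permutation $\pi$ of $\{1,\dots,n\}$ produced as follows. Choose a word of length $n$ of integers with independent letters, letter $i>0$ with probability $\alpha_i$, letter $-i$ ($i>0$) with probability $\beta_i$, letter $0$ with probability $\gamma$. Process the occurring letter values in increasing order of the integers, assigning consecutive blocks of $\{1,\dots,n\}$ starting from $1$: a negative value's block is written at its positions in decreasing order from left to right; the block of $0$ is written at its positions in uniformly random order; a positive value's block is written at its positions in increasing order from left to right. $\pi(p)$ is the integer at position $p$. Reversing the order of the cards replaces $\pi$ by $\pi\circ w_0$, $w_0(i)=n+1-i$. $\mu$ is the Möbius function. Extended power sums: $\tilde p_1(\vec{\alpha},\vec{\beta},\gamma)=\sum_i\alpha_i+\sum_i\beta_i+\gamma$ and $\tilde p_m(\vec{\alpha},\vec{\beta},\gamma)=\sum_i\alpha_i^m+(-1)^{m+1}\sum_i\beta_i^m$ for $m\ge2$. *)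

(* Defs.v *)
From HB Require Import structures.
From mathcomp Require Import all_boot all_order all_algebra all_fingroup.
From mathcomp Require Import mpoly.
From mathcomp Require Import boolp classical_sets filter reals topology normedtype sequences.

Set Implicit Arguments.
Unset Strict Implicit.
Unset Printing Implicit Defensive.

Import Order.TTheory GRing.Theory Num.Theory numFieldNormedType.Exports.
Local Open Scope ring_scope.

Section Shuffle.
Variable R : realType.

(* Conventions: alpha k stands for alpha_{k+1}, beta k for beta_{k+1}
   (k : nat), so the index i >= 1 of the paper is k.+1. *)

Definition moebius (d : nat) : R :=
  if all (fun p => logn p d == 1%N) (primes d) then (-1) ^+ size (primes d)
  else 0.

Definition ssum (a : nat -> R) : R := limn (series a).

Definition ptilde (alpha beta : nat -> R) (gamma : R) (m : nat) : R :=
  if m == 1%N then ssum alpha + ssum beta + gamma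
  else ssum (fun k => alpha k ^+ m)
       + (-1) ^+ m.+1 * ssum (fun k => beta k ^+ m).

Definition letter_prob (alpha beta : nat -> R) (gamma : R) (z : int) : R :=
  if (0 < z)%R then alpha (absz z).-1
  else if (z < 0)%R then beta (absz z).-1 else gamma.

(* Given the word w (letters at the n positions) and an auxiliary
   permutation tau used to order the positions of the 0-block, the
   (0-based) integer written at position p:
   (# positions with a smaller letter) + rank of p inside its block,
   where the block of a positive letter is written increasingly left to
   right, of a negative letter decreasingly, and the 0-block in the order
   given by tau. Averaging uniformly over tau in 'S_n yields a uniformly
   random order of the 0-block. *)
Definition shuffle_val (n : nat) (w : 'I_n -> int) (tau : 'S_n) (p : 'I_n)
  : nat :=
  #|[set q : 'I_n | (w q < w p)%R]|
  + #|[set q : 'I_n | (w q == w p) &&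
        (if (0 < w p)%R then (q < p)%N
         else if (w p < 0)%R then (p < q)%N
         else (tau q < tau p)%N)]|.

Definition shuffle_prob_trunc (alpha beta : nat -> R) (gamma : R)
  (n : nat) (pi : 'S_n) (K : nat) : R :=
  \sum_(w : {ffun 'I_n -> 'I_(K.*2.+1)})
    (\prod_(p < n) letter_prob alpha beta gamma ((w p)%:Z - K%:Z))
    * (#|[set tau : 'S_n |
           [forall p, (pi p : nat) == shuffle_val
                         (fun q => (w q)%:Z - K%:Z) tau p]]|%:R
       / (n`!)%:R).

(* Probability that the (alpha,beta,gamma) shuffle of n cards is pi:
   the (countable, nonnegative) sum over all words in Z^n, computed as
   the limit of the sums over words with letters in [-K, K]. *)
Definition shuffle_prob (alpha beta : nat -> R) (gamma : R)
  (n : nat) (pi : 'S_n) : R :=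
  limn (shuffle_prob_trunc alpha beta gamma pi).

Definition ncycles (n : nat) (pi : 'S_n) (i : nat) : nat :=
  #|[set c in porbits pi | #|c| == i]|.

(* The monomial prod_i x_i^{N_i(pi)} in {mpoly R[n]}; x_{i+1} is 'X_i. *)
Definition cycle_monomial (n : nat) (pi : 'S_n) : {mpoly R[n]} :=
  \prod_(i < n) 'X_i ^+ ncycles pi i.+1.

Definition w0 (n : nat) : 'S_n := perm (@rev_ord_inj n).
Definition reverse_cards (n : nat) (pi : 'S_n) : 'S_n := (w0 n * pi)%g.

Definition Ecyc (alpha beta : nat -> R) (gamma : R) (n : nat)
  : {mpoly R[n]} :=
  \sum_(pi : 'S_n) shuffle_prob alpha beta gamma pi *: cycle_monomial pi.

Definition Ecyc_rev (alpha beta : nat -> R) (gamma : R) (n : nat)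
  : {mpoly R[n]} :=
  \sum_(pi : 'S_n) shuffle_prob alpha beta gamma pi
                     *: cycle_monomial (reverse_cards pi).

(* Formal power series in u are handled by truncation: an element of
   {poly {mpoly R[n]}} with u = 'X.  exp truncated at order N (exact up to
   u^N when the argument has no constant term in u). *)
Definition exp_trunc (n N : nat) (z : {poly {mpoly R[n]}})
  : {poly {mpoly R[n]}} :=
  \sum_(k < N.+1) ((k`!)%:R)^-1 *: z ^+ k.

(* Coefficient of u^N in  prod_{i,j>=1} exp( (u^i x_i)^j / (ij) *
   sum_{d | i} mu(d) p~_{jd}^{i/d} ). Factors with i*j > N, and all
   variables x_i with i > N, only affect u-degrees > N; so the coefficient
   is that of the finite product over 1 <= i, j <= N, computed in
   {mpoly R[N]}. *)
Definition rhs_coef (alpha beta : nat -> R) (gamma : R) (N : nat)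
  : {mpoly R[N]} :=
  (\prod_(i < N) \prod_(j < N)
     exp_trunc N
       ('X^(i.+1 * j.+1) *
        ((('X_i : {mpoly R[N]}) ^+ j.+1 *
          ((((i.+1 * j.+1)%:R)^-1 *
            \sum_(d <- divisors i.+1)
               moebius d * ptilde alpha beta gamma (j.+1 * d) ^+ (i.+1 %/ d))
           %:MP_[N]))%:P)))`_N.

End Shuffle.

(* Main.v *)
Require Import Defs.
From HB Require Import structures.
From mathcomp Require Import all_boot all_order all_algebra all_fingroup.
From mathcomp Require Import mpoly.
From mathcomp Require Import boolp classical_sets filter reals topology normedtype sequences.
From mathcomp Require Import zify ring lra.

Set Implicit Arguments.
Unset Strict Implicit.
Unset Printing Implicit Defensive.

Import Order.TTheory GRing.Theory Num.Theory numFieldNormedType.Exports.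
Local Open Scope ring_scope.

(* Let [w] be a word over a finite ordered alphabet with positive and negative letters, [pi]
   its standardization and [sigma = pi^-1]. Sending a card [k] to the periodic word
   [w (sigma k), w (sigma^2 k), ...] intertwines [sigma] with the shift, and the words so
   obtained are sorted for a lexicographic order in which negative letters reverse
   comparisons. Hence [w] is determined by the multiplicities of the shift orbits (Gessel's
   bijection). Over an orbit of length [l] and multiplicity [m], [sigma^l] is monotone on each
   fibre: with an even number of negative letters there are [m] cycles of length [l], with an
   odd number [m mod 2] of length [l] and [m / 2] of length [2 l]. The cycle index is thus a
   product over the orbits, whose logarithmic derivative is computed by Moebius inversion;
   comparing logarithmic derivatives gives (1) for finite alphabets without the letter [0].
   The letter [0] is the limit of [M] letters of weight [gamma / M], and infinite alphabets
   are limits of finite ones.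

   For (2), [pi w0] is conjugate to [w0 pi], and [w0 pi] is the shuffle obtained from the word
   with all its letters negated. *)

(** * Logarithmic derivatives of truncated power series *)

Section LogDerivative.
Variable S : comNzRingType.
Implicit Types (f g : {poly S}) (N : nat).

(* [u f' = g f] modulo [u^(N+1)]: [g] is [u] times the logarithmic derivative of [f]. *)
Definition logderiv N f g :=
  forall i, (i <= N)%N -> ('X * f^`())`_i = (g * f)`_i.

Lemma coefXderiv f i : ('X * f^`())`_i = f`_i *+ i.
Proof. by case: i => [|i]; rewrite coefXM //= coef_deriv. Qed.

Lemma eq_coefM N (p p' q : {poly S}) :
  (forall i, (i <= N)%N -> p`_i = p'`_i) ->
  forall i, (i <= N)%N -> (q * p)`_i = (q * p')`_i.
Proof.
move=> Hp i Hi; rewrite !coefM; apply: eq_bigr => j _.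
by rewrite Hp // (leq_trans (leq_subr _ _)).
Qed.

Lemma logderiv1 N : logderiv N 1 0.
Proof. by move=> i _; rewrite derivC mulr0 mul0r. Qed.

Lemma logderivM N f1 g1 f2 g2 :
  logderiv N f1 g1 -> logderiv N f2 g2 -> logderiv N (f1 * f2) (g1 + g2).
Proof.
move=> H1 H2 i Hi.
have -> : 'X * (f1 * f2)^`() = f2 * ('X * f1^`()) + f1 * ('X * f2^`()).
  by rewrite derivM; ring.
have -> : (g1 + g2) * (f1 * f2) = f2 * (g1 * f1) + f1 * (g2 * f2) by ring.
by rewrite !coefD (eq_coefM _ H1) // (eq_coefM _ H2).
Qed.

Lemma logderiv_prod N (I : Type) (r : seq I) (P : pred I) (f g : I -> {poly S}) :
  (forall i, P i -> logderiv N (f i) (g i)) ->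
  logderiv N (\prod_(i <- r | P i) f i) (\sum_(i <- r | P i) g i).
Proof.
move=> H; elim/big_rec2: _ => [|i y1 y2 Pi IH]; first exact: logderiv1.
exact: logderivM (H _ Pi) IH.
Qed.

(** Chain rule for [u -> u^m]: the operator [u d/du] picks up the factor [m]. The order [N] is kept,
    since [m * j <= N] forces [j <= N]. *)
Lemma logderiv_comp N m f g : (0 < m)%N -> logderiv N f g ->
  logderiv N (f \Po 'X^m) ((g *+ m) \Po 'X^m).
Proof.
move=> m0 H i Hi; rewrite -comp_polyM coefXderiv !coef_comp_poly_Xn //.
case: ifP => [/dvdnP[j Ej]|_]; last by rewrite mul0rn.
rewrite {}Ej mulnK // in Hi *.
rewrite mulrnAl coefMn -H ?coefXderiv ?mulrnA //.
by rewrite (leq_trans _ Hi) // leq_pmulr.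
Qed.

(** Newton-type recursions on coefficients are the form in which logarithmic derivatives are checked
    below. Truncation is harmless: only indices at most [i] enter the recursion at [i]. *)
Lemma logderiv_coefs N (F G : nat -> S) :
  (forall i, (i <= N)%N -> F i *+ i = \sum_(j < i.+1) G j * F (i - j)%N) ->
  logderiv N (\poly_(j < N.+1) F j) (\poly_(j < N.+1) G j).
Proof.
move=> H i Hi; rewrite coefXderiv coefM coef_poly ltnS Hi H //.
apply: eq_bigr => j _; rewrite !coef_poly.
have Hj := ltn_ord j; have -> : (j < N.+1)%N by lia.
by have -> : (i - j < N.+1)%N by lia.
Qed.

(** The equation at degree [i] gives [i] times the coefficient in terms of lower ones. The first
    hypothesis, cancellation of positive integers, is what makes this recursion determine [f] over a
    general ring. *)
Lemma logderiv_uniq N f g f' g' :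
  (forall k (a b : S), a *+ k.+1 = b *+ k.+1 -> a = b) ->
  logderiv N f g -> logderiv N f' g' ->
  g`_0 = 0 -> g'`_0 = 0 -> (forall k, (0 < k <= N)%N -> g`_k = g'`_k) ->
  f`_0 = f'`_0 -> forall i, (i <= N)%N -> f`_i = f'`_i.
Proof.
move=> inj Hf Hf' g0 g0' Hg H0 i; elim/ltn_ind: i => -[//|i] IH Hi.
apply: (inj i); have := Hf _ Hi; have := Hf' _ Hi; rewrite !coefXderiv => -> ->.
rewrite !coefM [LHS]big_ord_recl [RHS]big_ord_recl /= g0 g0' !mul0r !add0r.
apply: eq_bigr => j _; have Hj := ltn_ord j.
by rewrite /bump /= !add1n subSS Hg ?IH //; lia.
Qed.

Lemma comp_poly_Xn n m (E : nat -> S) :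
  (\poly_(j < n) E j) \Po 'X^m = \sum_(j < n) E j *: 'X^(m * j).
Proof.
rewrite poly_def raddf_sum; apply: eq_bigr => j _ /=.
by rewrite comp_polyZ comp_Xn_poly exprM.
Qed.

End LogDerivative.

(** * The Möbius function *)

Section Moebius.
Variable R : realType.

Lemma moebius_pM p d : prime p -> (0 < d)%N -> ~~ (p %| d)%N ->
  moebius R (p * d) = - moebius R d.
Proof.
move=> pp d0 pd; have p0 := prime_gt0 pp.
have E : perm_eq (primes (p * d)) (p :: primes d).
  apply: uniq_perm; rewrite ?primes_uniq //=.
    by rewrite mem_primes (negPf pd) !andbF primes_uniq.
  by move=> q; rewrite primesM // primes_prime // !inE.
rewrite /moebius (perm_size E) (perm_all _ E) /=.
have -> : logn p (p * d) == 1%N.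
  by rewrite lognM // logn_prime // eqxx lognE pp d0 (negPf pd).
rewrite /= exprS mulN1r.
have -> : all (fun q => logn q (p * d) == 1%N) (primes d) =
          all (fun q => logn q d == 1%N) (primes d).
  apply: eq_in_all => q; rewrite mem_primes => /and3P[pq _ qd].
  rewrite lognM // logn_prime //; case: (q =P p) => // Epq.
  by rewrite -Epq qd in pd.
by case: ifP; rewrite ?oppr0.
Qed.

Lemma moebius_square p d : prime p -> (0 < d)%N -> (p ^ 2 %| d)%N ->
  moebius R d = 0.
Proof.
move=> pp d0 pd; rewrite /moebius; case: ifP => // /allP/(_ p) H.
rewrite pfactor_dvdn // in pd.
have pin : p \in primes d by rewrite -logn_gt0; lia.
by have /eqP := H pin; lia.
Qed.

(** Let [p] be the least prime divisor of [e]. Divisors divisible by [p ^ 2] contribute zero, and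
    the remaining multiples of [p] are [p * d] with [d] prime to [p], each cancelling against
    [d]. *)
Lemma sum_moebius e : (0 < e)%N ->
  \sum_(d <- divisors e) moebius R d = (e == 1)%N%:R.
Proof.
move=> e0; case: eqP => [->|/eqP e1].
  by rewrite /= big_seq1 /moebius.
have pp : prime (pdiv e) by apply: pdiv_prime; lia.
set p := pdiv e in pp; have p0 := prime_gt0 pp.
have pe : (p %| e)%N by apply: pdiv_dvd.
rewrite (bigID (fun d => p %| d)%N) /=.
rewrite (bigID (fun d => p %| d %/ p)%N) /= big1_seq ?add0r; last first.
  move=> d /andP[/andP[H1 H2]]; rewrite -dvdn_divisors // => de.
  apply: (moebius_square pp); first by rewrite (dvdn_gt0 e0).
  by rewrite -(divnK H1) -mulnn dvdn_pmul2r.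
rewrite -big_filter -[X in _ + X]big_filter.
set s1 := [seq i <- _ | _]; set s2 := [seq i <- _ | _].
have E : perm_eq s1 [seq (p * d)%N | d <- s2].
  apply: uniq_perm.
  - by rewrite filter_uniq // divisors_uniq.
  - rewrite map_inj_uniq ?filter_uniq ?divisors_uniq //.
    by move=> a b /eqP; rewrite eqn_pmul2l // => /eqP.
  move=> d; apply/idP/mapP.
    rewrite mem_filter -dvdn_divisors // => /andP[/andP[H1 H2] H3].
    exists (d %/ p)%N; last by rewrite mulnC divnK.
    by rewrite mem_filter H2 -dvdn_divisors // (dvdn_trans _ H3) // dvdn_div.
  move=> [b]; rewrite mem_filter -dvdn_divisors // => /andP[H1 H2] ->.
  rewrite mem_filter -dvdn_divisors // mulKn // H1 dvdn_mulr //=.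
  by rewrite Gauss_dvd ?pe // prime_coprime.
rewrite (perm_big _ E) big_map /= -big_split big1_seq //= => d.
rewrite mem_filter -dvdn_divisors // => /andP[H1 H2].
by rewrite moebius_pM ?addNr // (dvdn_gt0 e0).
Qed.

(** Write the sign as [-1] plus twice the indicator that [e %/ d] is even. The [d] with [e %/ d]
    even are the divisors of [e./2] when [e] is even, and there are none when [e] is odd, so
    [sum_moebius] applies twice. *)
Lemma sum_moebius_sign e : (0 < e)%N ->
  \sum_(d <- divisors e) moebius R d * (-1) ^+ (e %/ d)%N =
  - (e == 1)%N%:R + (e == 2)%N%:R *+ 2.
Proof.
move=> e0.
have E d : (-1) ^+ (e %/ d)%N = - 1 + (~~ odd (e %/ d)%N)%:R *+ 2 :> R.
  by rewrite -signr_odd; case: odd; rewrite /= ?mul0rn ?addr0 // expr0 mulr2n addKr.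
under eq_bigr do rewrite E mulrDr mulrN1 mulrnAr.
rewrite big_split /= sumrN sum_moebius //; congr (_ + _).
rewrite sumrMnl; congr (_ *+ _).
case: (boolP (odd e)) => [oe|/negbTE ee].
  have -> : (e == 2)%N = false by case: eqP oe => // ->.
  rewrite big1_seq // => d; rewrite -dvdn_divisors // => /= de.
  by rewrite -{1}(divnK de) oddM in oe; case/andP: oe => -> _; rewrite mulr0.
have e2 : (0 < e./2)%N by have := odd_double_half e; rewrite ee; lia.
rewrite -(_ : (e./2 == 1)%N = (e == 2)%N) -?sum_moebius //; last first.
  by have := odd_double_half e; rewrite ee; lia.
under eq_bigr do rewrite mulr_natr mulrb.
rewrite -big_mkcond -big_filter; apply: perm_big; apply: uniq_perm.
- by rewrite filter_uniq // divisors_uniq.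
- exact: divisors_uniq.
move=> d; rewrite mem_filter -!dvdn_divisors //.
have Ee : e = (e./2 * 2)%N by rewrite -[LHS]odd_double_half ee muln2.
apply/andP/idP => [[H1 de]|H].
  rewrite -(dvdn_pmul2r (p := 2)) // -Ee -{1}(divnK de) mulnC.
  by rewrite dvdn_pmul2r ?dvdn2 // (dvdn_gt0 e0).
split; last by rewrite Ee dvdn_mulr.
by rewrite {1}Ee mulnC -muln_divA // oddM.
Qed.

End Moebius.

(** * Ranks and orbits *)

Section RankPermutation.
Variable n : nat.
Implicit Type lt : rel 'I_n.

Definition strict_total lt :=
  [/\ irreflexive lt, transitive lt & forall p q, p != q -> lt p q || lt q p].

Definition rank lt p := #|[set q | lt q p]|.

Lemma rank_mono lt (H : strict_total lt) p q : (rank lt p < rank lt q)%N = lt p q.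
Proof.
case: H => irr tr tot.
have mono a b : lt a b -> (rank lt a < rank lt b)%N.
  move=> ab; apply: proper_card; apply/properP; split.
    by apply/fintype.subsetP => c; rewrite !inE => ca; apply: tr ab.
  by exists a; rewrite !inE ?irr.
apply/idP/idP => [|/mono//]; case: (eqVneq p q) => [->|/tot/orP[//|/mono]].
  by rewrite ltnn.
by move=> H1 H2; have := ltn_trans H1 H2; rewrite ltnn.
Qed.

Lemma rank_lt lt (H : strict_total lt) p : (rank lt p < n)%N.
Proof.
case: H => irr _ _; rewrite -[X in (_ < X)%N](card_ord n) -cardsT.
apply: proper_card.
by apply/properP; split; [apply: finset.subsetT | exists p; rewrite !inE ?irr].
Qed.

Lemma rank_inj lt (H : strict_total lt) : injective (fun p => Ordinal (rank_lt H p)).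
Proof.
move=> p q [/eqP E]; apply/eqP; apply: contraTT E; case: (H) => _ _ tot /tot.
by rewrite -!(rank_mono H) neq_ltn.
Qed.

Definition rank_perm lt (H : strict_total lt) : 'S_n := perm (@rank_inj lt H).

Lemma rank_permE lt (H : strict_total lt) p : rank_perm H p = rank lt p :> nat.
Proof. by rewrite permE. Qed.

Lemma rank_perm_lt lt (H : strict_total lt) p q :
  (rank_perm H p < rank_perm H q)%N = lt p q.
Proof. by rewrite !rank_permE rank_mono. Qed.

Lemma eq_rank lt lt' p : lt =2 lt' -> rank lt p = rank lt' p.
Proof. by move=> E; apply: eq_card => q; rewrite !inE E. Qed.

Lemma eq_rank_perm lt lt' (H : strict_total lt) (H' : strict_total lt') :
  lt =2 lt' -> rank_perm H = rank_perm H'.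
Proof.
by move=> E; apply/permP => p; apply: val_inj; rewrite /= !rank_permE (eq_rank _ E).
Qed.

End RankPermutation.

Lemma perm_iter_fix (T : finType) (s : {perm T}) x d :
  ((s ^+ d)%g x == x) = (#|porbit s x| %| d)%N.
Proof.
set l := #|porbit s x|.
have l0 : (0 < l)%N by apply/card_gt0P; exists x; apply: porbit_id.
have fixl q : iter (q * l) s x = x.
  by elim: q => // q IH; rewrite mulSn iterD IH iter_porbit.
rewrite permX {1}(divn_eq d l) addnC iterD fixl /dvdn.
have rl : (d %% l < l)%N by rewrite ltn_mod.
have := uniq_traject_porbit s x; rewrite -/l => /(nth_uniq x) U.
have := U (d %% l)%N 0%N; rewrite !size_traject !nth_traject //= => -> //.
Qed.

Lemma big_porbit (T : finType) (s : {perm T}) x (U : Type) (idx : U)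
    (op : Monoid.com_law idx) (F : T -> U) :
  \big[op/idx]_(y in porbit s x) F y =
  \big[op/idx]_(t < #|porbit s x|) F ((s ^+ t)%g x).
Proof.
have E : perm_eq (enum (porbit s x)) (traject s x #|porbit s x|).
  apply: uniq_perm; rewrite ?enum_uniq ?uniq_traject_porbit // => y.
  by rewrite mem_enum porbit_traject.
rewrite -big_enum /= (perm_big _ E) /=.
rewrite -[RHS](big_mkord xpredT (fun t => F ((s ^+ t)%g x))) (big_nth x) size_traject.
by apply: eq_big_nat => i /andP[_ Hi]; rewrite nth_traject // permX.
Qed.

(** * Standardization of words *)

Section Standardization.
Variables (A : finType) (key : A -> nat) (neg : A -> bool) (n : nat).
Hypothesis key_inj : injective key.
Implicit Types (w : 'I_n -> A) (k l : 'I_n).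

Definition std_lt w : rel 'I_n := fun q p =>
  (key (w q) < key (w p))%N
  || ((w q == w p) && (if neg (w p) then (p < q)%N else (q < p)%N)).

Lemma std_total w : strict_total (std_lt w).
Proof.
rewrite /std_lt; split=> [p|q p r|p q pq].
- by rewrite !ltnn eqxx /=; case: ifP.
- move=> /orP[H1|/andP[/eqP H1 H1']] /orP[H2|/andP[/eqP H2 H2']].
  + by rewrite (ltn_trans H1 H2).
  + by rewrite -H2 H1.
  + by rewrite H1 H2.
  + rewrite H1 H2 eqxx ltnn /=; rewrite H2 in H1'.
    by move: H1' H2'; case: ifP => _ ? ?; lia.
- case: (eqVneq (w p) (w q)) => [->|wpq].
    rewrite !ltnn /=; move: pq; rewrite neq_ltn.
    by case: ifP => _; rewrite // orbC.
  by rewrite !orbF -neq_ltn (inj_eq key_inj).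
Qed.

Definition std w : 'S_n := rank_perm (std_total w).
(** The position holding a given card. The inverse is used because the letters read at the positions
    of cards [0, 1, ...] are weakly increasing. *)
Definition succ_pos w : 'S_n := (std w)^-1%g.
Local Notation sg := succ_pos.

Lemma key_succ_pos w k l : (k <= l)%N -> (key (w (sg w k)) <= key (w (sg w l)))%N.
Proof.
rewrite leq_eqVlt => /orP[/eqP/val_inj->//|].
rewrite -{1}(permKV (std w) k) -{1}(permKV (std w) l) rank_perm_lt.
by move=> /orP[/ltnW//|/andP[/eqP->]].
Qed.

Lemma succ_pos_mono w k l : (k < l)%N -> w (sg w k) = w (sg w l) ->
  if neg (w (sg w k)) then (sg w l < sg w k)%N else (sg w k < sg w l)%N.
Proof.
rewrite -{1}(permKV (std w) k) -{1}(permKV (std w) l) rank_perm_lt.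
move=> /orP[H E|/andP[_ H]]; first by rewrite /sg in E; rewrite E ltnn in H.
by move=> ->.
Qed.

Lemma perm_expg_fact (s : 'S_n) : (s ^+ n`!)%g = 1%g.
Proof.
apply/permP => k; rewrite perm1; apply/eqP; rewrite perm_iter_fix dvdn_fact //.
apply/andP; split; first by apply/card_gt0P; exists k; apply: porbit_id.
by rewrite -[X in (_ <= X)%N](card_ord n) max_card.
Qed.

(** Infinite words of period dividing [n!], a common multiple of all cycle lengths in ['S_n]; they
    form a finite type, on which the shift is a permutation. *)
Definition periodic_word := {ffun 'I_(n`!) -> A}.
Implicit Types p q : periodic_word.

Definition letter p (j : nat) := p (Ordinal (ltn_pmod j (fact_gt0 n))).

Lemma letter_inj p q : (forall j, (j < n`!)%N -> letter p j = letter q j) -> p = q.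
Proof.
move=> H; apply/ffunP => i; have := H i (ltn_ord i); rewrite /letter.
by congr (p _ = q _); apply: val_inj; rewrite /= modn_small.
Qed.

Lemma eq_letter p i j : i = j %[mod n`!] -> letter p i = letter p j.
Proof. by move=> E; congr (p _); apply: val_inj. Qed.

Lemma letterE (f : nat -> A) j :
  (forall i j, i = j %[mod n`!] -> f i = f j) ->
  letter [ffun i => f (nat_of_ord i)] j = f j.
Proof. by move=> H; rewrite /letter ffunE /=; apply: H; rewrite modn_mod. Qed.

Definition shift p : periodic_word := [ffun i => letter p (nat_of_ord i).+1].

Lemma letter_shift p j : letter (shift p) j = letter p j.+1.
Proof.
rewrite /shift (@letterE (fun i => letter p i.+1)) // => a b E.
by apply: eq_letter; rewrite -addn1 -modnDml E modnDml addn1.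
Qed.

Lemma shift_inj : injective shift.
Proof.
move=> p q E; apply: letter_inj => j _; have L0 := fact_gt0 n.
have H r : letter r j = letter r (j + n`!).-1.+1.
  by apply: eq_letter; rewrite prednK ?modnDr //; lia.
by rewrite !H -!letter_shift E.
Qed.

Definition rot_perm : {perm periodic_word} := perm shift_inj.
Local Notation T := rot_perm.

Lemma letter_rot p i j : letter ((T ^+ i)%g p) j = letter p (j + i).
Proof.
elim: i j => [|i IH] j; first by rewrite expg0 perm1 addn0.
by rewrite expgSr permM permE letter_shift IH addSnnS.
Qed.

(** The exponent starts at [1], so the first letter is monotone in [k], while [w k] itself appears
    as the last letter of the period. *)
Definition orbit_word w k : periodic_word :=
  [ffun i => w ((sg w ^+ (nat_of_ord i).+1)%g k)].

Lemma letter_orbit w k j : letter (orbit_word w k) j = w ((sg w ^+ j.+1)%g k).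
Proof.
rewrite /orbit_word (@letterE (fun i => w ((sg w ^+ i.+1)%g k))) // => a b E.
by rewrite !expgS -(expg_mod _ (perm_expg_fact _)) E expg_mod // perm_expg_fact.
Qed.

Lemma rot_orbit_word w k : T (orbit_word w k) = orbit_word w (sg w k).
Proof.
apply: letter_inj => j _.
by rewrite permE letter_shift !letter_orbit [in LHS]expgS permM.
Qed.

Lemma rot_orbit_wordX w k i : (T ^+ i)%g (orbit_word w k) = orbit_word w ((sg w ^+ i)%g k).
Proof.
elim: i => [|i IH]; first by rewrite !expg0 !perm1.
by rewrite !expgSr !permM IH rot_orbit_word.
Qed.

Lemma orbit_word_last w k : letter (orbit_word w k) (n`!).-1 = w k.
Proof. by rewrite letter_orbit prednK ?fact_gt0 // perm_expg_fact perm1. Qed.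

(* The first [f] letters of [a], read as a base [B] number in which a negative letter
   complements the remaining digits: the words [orbit_word w k] are sorted for this order. *)
Definition base := (\max_(a : A) key a).+1.

Fixpoint code (f : nat) (a : nat -> A) : nat :=
  if f is f'.+1 then
    let c := code f' (fun i => a i.+1) in
    (key (a 0) * base ^ f' + (if neg (a 0) then (base ^ f').-1 - c else c))%N
  else 0%N.

Lemma eq_code f a b : a =1 b -> code f a = code f b.
Proof.
by elim: f a b => //= f IH a b E; rewrite E (IH _ (fun i => b i.+1)).
Qed.

Lemma key_lt_base (a : A) : (key a < base)%N.
Proof. by rewrite /base ltnS (leq_bigmax a). Qed.

Lemma code_lt f a : (code f a < base ^ f)%N.
Proof.
elim: f a => [|f IH] a //=; have := IH (fun i => a i.+1).
set c := code _ _ => Hc; rewrite expnS.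
have H : (base ^ f + key (a 0%N) * base ^ f <= base * base ^ f)%N.
  by rewrite -mulSn leq_mul2r key_lt_base orbT.
by apply: leq_trans H; case: ifP => _; lia.
Qed.

Lemma code_inj f a b : code f a = code f b -> forall i, (i < f)%N -> a i = b i.
Proof.
elim: f a b => //= f IH a b.
have := code_lt f (fun i => a i.+1); have := code_lt f (fun i => b i.+1).
set c := code _ _; set d := code _ _ => Hc Hd E.
pose rem (x : A) c := (if neg x then (base ^ f).-1 - c else c)%N.
have Hr x e : (e < base ^ f -> rem x e < base ^ f)%N.
  by rewrite /rem; case: ifP => _; lia.
have E1 := congr1 (fun m => m %/ base ^ f)%N E.
have B0 : (0 < base ^ f)%N by rewrite expn_gt0.
rewrite !divnMDl // !divn_small ?Hr // !addn0 in E1.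
have E0 := key_inj E1; move: E; rewrite E0 => /addnI E.
have Ecd : d = c by move: E; case: ifP => _; lia.
by case=> [//|i]; rewrite ltnS => Hi; exact: (IH _ _ Ecd).
Qed.

(** Induction on the number of letters read. First letters are sorted by [key_succ_pos]; on a tie,
    [succ_pos] keeps the order for a positive letter and reverses it for a negative one, which the
    complement in [code] undoes. *)
Lemma code_orbit_word f w k l : (k <= l)%N ->
  (code f (letter (orbit_word w k)) <= code f (letter (orbit_word w l)))%N.
Proof.
pose cd f k := code f (letter (orbit_word w k)).
rewrite -/(cd f k) -/(cd f l); elim: f k l => // f IH k l kl.
have E m : cd f.+1 m = (key (w (sg w m)) * base ^ f +
    (if neg (w (sg w m)) then (base ^ f).-1 - cd f (sg w m) else cd f (sg w m)))%N.
  rewrite {1}/cd /= letter_orbit expg1.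
  have -> // : code f (fun i => letter (orbit_word w m) i.+1) = cd f (sg w m).
  by apply: eq_code => i; rewrite !letter_orbit [in LHS]expgS permM.
have lt m : (cd f m < base ^ f)%N by apply: code_lt.
rewrite !E; have := key_succ_pos w kl; rewrite leq_eqVlt => /orP[/eqP/key_inj Ew|Hlt].
  rewrite -Ew leq_add2l; move: kl; rewrite leq_eqVlt => /orP[/eqP/val_inj->//|kl].
  have := succ_pos_mono kl Ew; case: ifP => _ /ltnW/IH H; last exact: H.
  exact: leq_sub2l.
have Hr x m : ((if neg x then (base ^ f).-1 - cd f m else cd f m) < base ^ f)%N.
  by have := lt m; case: ifP => _; lia.
have := Hr (w (sg w k)) (sg w k); set r := (if _ then _ else _) => Hrr.
apply: (leq_trans _ (leq_addr _ _)); apply: leq_trans (_ : (key (w (sg w k))).+1 * base ^ f <= _)%N.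
  by rewrite mulSn; lia.
by rewrite leq_mul2r Hlt orbT.
Qed.

Definition multiplicity w p := #|[set k | orbit_word w k == p]|.

(** Multiplicities give the multiset of orbit words, hence of their codes. Since codes increase with
    the card, sorting recovers the word of each card [k], whose last letter is [w k]. *)
Lemma mult_inj w w' : multiplicity w =1 multiplicity w' -> w =1 w'.
Proof.
move=> E.
pose s v := [seq orbit_word v k | k <- enum 'I_n].
pose cs v := [seq code n`! (letter p) | p <- s v].
have Hs v : sorted leq (cs v).
  rewrite /cs /s -map_comp sorted_map.
  apply: (@sub_sorted _ (relpre val leq)); first by move=> k l; apply: code_orbit_word.
  by rewrite -sorted_map val_enum_ord iota_sorted.
have Hp : perm_eq (s w) (s w').
  apply/allP => p _ /=; apply/eqP.
  have H v : count_mem p (s v) = multiplicity v p.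
    by rewrite /s count_map -sum1_count big_enum_cond sum1dep_card /multiplicity cardsE.
  by rewrite !H.
have Ec : cs w = cs w'.
  apply: (sorted_eq leq_trans anti_leq) => //; exact: perm_map.
move=> k; rewrite -(orbit_word_last w) -(orbit_word_last w').
have Hn v : nth 0%N (cs v) k = code n`! (letter (orbit_word v k)).
  rewrite /cs /s (nth_map (orbit_word v k)) 1?size_map ?size_enum_ord //.
  by rewrite (nth_map k) ?size_enum_ord // nth_ord_enum.
have := congr1 (fun t => nth 0%N t k) Ec; rewrite /= !Hn => /code_inj; apply.
by rewrite prednK ?fact_gt0.
Qed.

End Standardization.

Lemma big_porbits (T : finType) (s : {perm T}) (U : Type) (idx : U)
    (op : Monoid.com_law idx) (F : T -> U) :
  \big[op/idx]_x F x = \big[op/idx]_(C in porbits s) \big[op/idx]_(x in C) F x.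
Proof.
rewrite (partition_big (porbit s) (mem (porbits s))) /=; last first.
  by move=> x _; apply: imset_f.
apply: eq_bigr => _ /imsetP[y _ ->]; apply: eq_bigl => x /=.
by rewrite eq_porbit_mem.
Qed.

Lemma big_periodic (U : Type) (idx : U) (op : Monoid.law idx) (F : nat -> U) l j :
  (forall t, F (t + l)%N = F t) ->
  \big[op/idx]_(t < l * j) F t = iter j (op (\big[op/idx]_(t < l) F t)) idx.
Proof.
move=> H; elim: j => [|j IH]; first by rewrite muln0 big_ord0.
rewrite iterS -IH mulnS big_split_ord /=; congr (op _ _).
by apply: eq_bigr => t _; rewrite addnC H.
Qed.

(** * Cycles of a standardized word lying over a shift orbit *)

Section CyclesOfWords.
Variables (A : finType) (key : A -> nat) (neg : A -> bool) (n : nat).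
Hypothesis key_inj : injective key.
Implicit Types (w : 'I_n -> A) (k l : 'I_n).
Local Notation T := (rot_perm A n).
Local Notation sg := (succ_pos neg key_inj).
Local Notation ow := (orbit_word neg key_inj).
Implicit Types (p q : periodic_word A n) (O : {set periodic_word A n}).

Definition odd_sign e p := \big[addb/false]_(t < e) neg (letter p t).
Definition odd_orbit O := \big[addb/false]_(p in O) neg (letter p 0).

Lemma odd_sign_orbit p : odd_sign #|porbit T p| p = odd_orbit (porbit T p).
Proof.
rewrite /odd_orbit big_porbit; apply: eq_bigr => t _.
by rewrite letter_rot.
Qed.

Lemma letter_periodic p t : letter p (t + #|porbit T p|) = letter p t.
Proof.
by rewrite -letter_rot; congr letter; apply/eqP; rewrite perm_iter_fix.
Qed.

(** Two cards with the same orbit word read the same letters forever, so every application of [sg w]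
    compares them by one common letter: a negative one swaps their order, a positive one keeps
    it. *)
Lemma odd_sign_mono e w k l : (k < l)%N -> ow w k = ow w l ->
  if odd_sign e (ow w k) then ((sg w ^+ e)%g l < (sg w ^+ e)%g k)%N
  else ((sg w ^+ e)%g k < (sg w ^+ e)%g l)%N.
Proof.
move=> kl E; elim: e => [|e IH].
  by rewrite /odd_sign big_ord0 !expg0 !perm1.
rewrite /odd_sign big_ord_recr /= -/(odd_sign e (ow w k)) !expgSr !permM.
have Ee : ow w ((sg w ^+ e)%g k) = ow w ((sg w ^+ e)%g l).
  by rewrite -!rot_orbit_wordX E.
have Hl v : letter (ow w v) 0 = w (sg w v) by rewrite letter_orbit expg1.
have El : w (sg w ((sg w ^+ e)%g k)) = w (sg w ((sg w ^+ e)%g l)).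
  by rewrite -!Hl Ee.
have -> : letter (ow w k) e = w (sg w ((sg w ^+ e)%g k)).
  by rewrite -Hl -rot_orbit_wordX letter_rot.
move: IH; case: odd_sign => /= IH.
  have := succ_pos_mono IH (esym El).
  by rewrite -El; case: neg.
by have := succ_pos_mono IH El; case: neg.
Qed.

(** If the sign were even, [sg w ^+ e] would be increasing on the fibre of [k]. The iterates of [k],
    once it moves, would then drift strictly in one direction, contradicting that the [n!]-th
    iterate is [k]. *)
Lemma even_return_fix e w k : (sg w ^+ e)%g k != k ->
  ow w ((sg w ^+ e)%g k) = ow w k -> odd_sign e (ow w k).
Proof.
set g := (sg w ^+ e)%g => gk E; apply: contraT => ev.
have Ea a : ow w ((g ^+ a)%g k) = ow w k.
  elim: a => [|a IH]; first by rewrite expg0 perm1.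
  by rewrite expgSr permM -rot_orbit_wordX IH rot_orbit_wordX.
have step (u v : 'I_n) : (u < v)%N -> ow w u = ow w k -> ow w v = ow w k -> (g u < g v)%N.
  move=> uv Eu Ev; have := @odd_sign_mono e w u v uv.
  by rewrite Eu Ev (negbTE ev); apply.
have fin : (g ^+ n`!)%g k = k by rewrite perm_expg_fact perm1.
case/orP: (etrans (esym (neq_ltn _ _)) gk) => [lt|lt].
  have H a : ((g ^+ a.+1)%g k < k)%N.
    elim: a => [|a IH]; first by rewrite expg1.
    by rewrite expgSr permM; apply: leq_trans (step _ _ IH (Ea _) erefl) (ltnW lt).
  by have := H (n`!).-1; rewrite prednK ?fact_gt0 // fin ltnn.
have H a : (k < (g ^+ a.+1)%g k)%N.
  elim: a => [|a IH]; first by rewrite expg1.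
  by rewrite expgSr permM; apply: leq_trans lt (ltnW (step _ _ IH erefl (Ea _))).
by have := H (n`!).-1; rewrite prednK ?fact_gt0 // fin ltnn.
Qed.

(** [l] divides the cycle length because the word must return. With an even sign, [sg w ^+ l] fixes
    [k]; with an odd one, [sg w ^+ l.*2] has even sign and fixes [k], leaving [l] or [l.*2]. *)
Lemma card_cycle w k (l := #|porbit T (ow w k)|) :
  #|porbit (sg w) k| = l \/
  odd_orbit (porbit T (ow w k)) /\ #|porbit (sg w) k| = l.*2.
Proof.
set d := #|porbit (sg w) k|.
have l0 : (0 < l)%N by apply/card_gt0P; exists (ow w k); apply: porbit_id.
have ld : (l %| d)%N.
  rewrite -perm_iter_fix rot_orbit_wordX.
  by have /eqP-> : (sg w ^+ d)%g k == k by rewrite perm_iter_fix.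
have ret e : (l %| e)%N -> ow w ((sg w ^+ e)%g k) = ow w k.
  by move=> le; rewrite -rot_orbit_wordX; apply/eqP; rewrite perm_iter_fix.
have fixd e : (l %| e)%N -> odd_sign e (ow w k) = false -> (d %| e)%N.
  move=> le ev; rewrite -perm_iter_fix; apply: contraFT ev => H.
  by apply: even_return_fix => //; apply: ret.
case: (boolP (odd_orbit _)) => [od|ev]; last first.
  left; apply/eqP; rewrite eqn_dvd ld andbT; apply: fixd => //.
  by rewrite odd_sign_orbit (negbTE ev).
have d2 : (d %| l.*2)%N.
  apply: fixd; first by rewrite -muln2 dvdn_mulr.
  rewrite -muln2 /odd_sign (@big_periodic _ _ _ (fun t => neg (letter (ow w k) t))).
    by rewrite /= addbF addbb.
  by move=> t; rewrite letter_periodic.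
case/dvdnP: ld => a Ea; rewrite Ea in d2 *.
have : (a %| 2)%N by rewrite -(dvdn_pmul2r l0) mul2n.
rewrite dvdn_divisors // => /= ; rewrite !inE => /orP[/eqP->|/eqP->].
  by left; rewrite mul1n.
by right; rewrite mul2n.
Qed.

(** Over an odd orbit [sg w ^+ l] is decreasing on each fibre, and a decreasing map has at most one
    fixed point. *)
Lemma odd_short_cycle_uniq w k k' (l := #|porbit T (ow w k)|) :
  ow w k' \in porbit T (ow w k) -> odd_orbit (porbit T (ow w k)) ->
  #|porbit (sg w) k| = l -> #|porbit (sg w) k'| = l ->
  porbit (sg w) k = porbit (sg w) k'.
Proof.
rewrite porbit_sym => /porbitP[i Ei] od Hk Hk'.
(* Move [k'] along its cycle to a card with the same orbit word as [k]. *)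
have : porbit (sg w) k' = porbit (sg w) ((sg w ^+ i)%g k').
  by apply/eqP; rewrite eq_porbit_mem porbit_sym mem_porbit.
rewrite rot_orbit_wordX in Ei => Eo; rewrite Eo in Hk' *.
move: Ei Hk' {Eo}; set k2 := (sg w ^+ i)%g k' => Ei Hk'.
suff -> : k = k2 by [].
have od' : odd_sign l (ow w k) by rewrite odd_sign_orbit.
have F1 : (sg w ^+ l)%g k = k by apply/eqP; rewrite perm_iter_fix Hk.
have F2 : (sg w ^+ l)%g k2 = k2 by apply/eqP; rewrite perm_iter_fix Hk'.
apply/eqP; apply: contraT; rewrite neq_ltn => /orP[H|H].
  by have := odd_sign_mono l H Ei; rewrite od' F1 F2 ltnNge (ltnW H).
by have := odd_sign_mono l H (esym Ei); rewrite -Ei od' F1 F2 ltnNge (ltnW H).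
Qed.

End CyclesOfWords.

(** * Multiplicities of orbits *)

Section CycleWeights.
Variables (S : comNzRingType) (x : nat -> S).

(* Contribution of the cycles lying over an orbit of length [l] visited [j] times, when
   the orbit has an odd ([b = true]) or even number of negative letters. *)
Definition cycF (b : bool) (l j : nat) : S :=
  if b then x l ^+ odd j * x l.*2 ^+ j./2 else x l ^+ j.

(** The generating function of [cycF] in [z] is [1 / (1 - x_l z)] in the even case and
    [(1 + x_l z) / (1 - x_(2l) z^2)] in the odd case; these are the coefficients of [z] times its
    logarithmic derivative. *)
Definition cycG (b : bool) (l j : nat) : S :=
  if j == 0%N then 0 else
  if b then (-1) ^+ j.+1 * x l ^+ j + ((~~ odd j)%:R * x l.*2 ^+ j./2) *+ 2
  else x l ^+ j.

Lemma cycFG0 b l m : cycF b l m *+ m = \sum_(j < m.+1) cycG b l j * cycF b l (m - j).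
Proof.
case: b; last first.
  rewrite big_ord_recl {1}/cycG /= mul0r add0r -[in LHS](card_ord m) -sumr_const.
  apply: eq_bigr => j _; rewrite /cycG /cycF /= -exprD.
  by congr (_ ^+ _); rewrite card_ord; have /= := ltn_ord j; rewrite /bump; lia.
(* Odd case, by steps of two: [cycF] at [m + 2] is [cycF] at [m] times [x l.*2], so all but the last
   two terms of the sum come from the induction hypothesis. *)
elim/ltn_ind: m => -[_|[_|m IH]].
- by rewrite big_ord_recl big_ord0 /cycG /= mul0r mulr0n addr0.
- rewrite !big_ord_recl big_ord0 /cycG /cycF /= mulr1n mul0r !expr0 !expr1 mul0r.
  by rewrite -signr_odd /= !mul0rn; ring.
rewrite big_ord_recr big_ord_recr /= subnn subSnn.
have -> : \sum_(i < m.+1) cycG true l i * cycF true l (m.+2 - i) =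
          (cycF true l m *+ m) * x l.*2.
  rewrite IH // mulr_suml; apply: eq_bigr => j _; rewrite -mulrA; congr (_ * _).
  have -> : (m.+2 - j = (m - j).+2)%N by have := ltn_ord j; lia.
  by rewrite /cycF /= negbK exprSr mulrA.
rewrite /cycF /cycG /= -[(-1) ^+ m.+2]signr_odd -[(-1) ^+ m.+3]signr_odd /= !negbK uphalf_half.
by case: (odd m) => /=; rewrite ?add1n ?add0n !exprS !expr0; ring.
Qed.

Lemma cycFG b l (z : S) m : (cycF b l m * z ^+ m) *+ m =
  \sum_(j < m.+1) (cycG b l j * z ^+ j) * (cycF b l (m - j) * z ^+ (m - j)).
Proof.
rewrite -mulrnAl cycFG0 mulr_suml; apply: eq_bigr => j _.
by rewrite mulrACA -exprD subnKC // -ltnS.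
Qed.

End CycleWeights.

Section Multiplicities.
Variables (A : finType) (key : A -> nat) (neg : A -> bool) (n : nat).
Hypothesis key_inj : injective key.
Implicit Types (w : 'I_n -> A) (k l : 'I_n).
Local Notation T := (rot_perm A n).
Local Notation sg := (succ_pos neg key_inj).
Local Notation ow := (orbit_word neg key_inj).
Local Notation mult := (multiplicity neg key_inj).
Implicit Types (p q : periodic_word A n) (O : {set periodic_word A n}).

(** [sg w] carries the cards over [p] bijectively onto the cards over [T p]. *)
Lemma mult_porbit w p q : q \in porbit T p -> mult w q = mult w p.
Proof.
case/porbitP=> i ->{q}; elim: i => [|i IH]; first by rewrite expg0 perm1.
rewrite -{}IH expgSr permM; set q := (T ^+ i)%g p; rewrite /multiplicity.
rewrite -[RHS](card_imset _ (@perm_inj _ (sg w))); apply: eq_card => k; rewrite inE.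
apply/eqP/imsetP => [E|[k' H ->]]; last by move: H; rewrite inE -rot_orbit_word => /eqP->.
exists ((sg w)^-1%g k); last by rewrite permKV.
by rewrite inE -(inj_eq (@perm_inj _ T)) rot_orbit_word permKV E.
Qed.

(** The common multiplicity of the words of [O], obtained by an exact division so that no
    representative has to be chosen. *)
Definition orbit_mult w O := (#|[set k | ow w k \in O]| %/ #|O|)%N.

Lemma card_over_set w O : #|[set k | ow w k \in O]| = (\sum_(p in O) mult w p)%N.
Proof.
rewrite -sum1dep_card (partition_big (ow w) (mem O)) //=.
apply: eq_bigr => p pO; rewrite /multiplicity sum1dep_card; apply: eq_card => k.
by rewrite !inE; apply: andb_idl => /eqP->.
Qed.

Lemma orbit_multE w O p : O \in porbits T -> p \in O -> mult w p = orbit_mult w O.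
Proof.
case/imsetP=> q _ -> pq; rewrite /orbit_mult card_over_set.
rewrite (eq_bigr (fun _ => mult w p)); last first.
  by move=> r rq; rewrite (mult_porbit _ rq) (mult_porbit _ pq).
by rewrite sum_nat_const mulKn //; apply/card_gt0P; exists p.
Qed.

Lemma card_over_orbit w O : O \in porbits T ->
  #|[set k | ow w k \in O]| = (#|O| * orbit_mult w O)%N.
Proof.
move=> OT; rewrite card_over_set -sum_nat_const.
by apply: eq_bigr => p pO; apply: orbit_multE.
Qed.

Lemma sum_orbit_mult w : (\sum_(O in porbits T) #|O| * orbit_mult w O = n)%N.
Proof.
rewrite -[RHS]card_ord -sum1_card (partition_big (fun k => porbit T (ow w k)) (mem (porbits T))) /=.
  apply: eq_bigr => O OT; rewrite -card_over_orbit // sum1dep_card.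
  apply: eq_card => k; rewrite !inE.
  by case/imsetP: OT => q _ ->; rewrite eq_porbit_mem.
by move=> k _; apply: imset_f.
Qed.

Variables (S : comNzRingType) (x : nat -> S) (c : A -> S).

Definition orbit_weight O : S := \prod_(p in O) c (letter p 0).

Lemma prod_letters w :
  \prod_k c (w k) = \prod_(O in porbits T) orbit_weight O ^+ orbit_mult w O.
Proof.
rewrite (reindex_inj (@perm_inj _ (sg w))) /=.
have E k : w (sg w k) = letter (ow w k) 0 by rewrite letter_orbit expg1.
under eq_bigr do rewrite E.
rewrite (partition_big (ow w) xpredT) //= (big_porbits T).
apply: eq_bigr => O OT; rewrite /orbit_weight -prodrXl.
apply: eq_bigr => p pO; rewrite -(orbit_multE w OT pO).
rewrite (eq_bigr (fun _ => c (letter p 0))) => [|k /eqP-> //].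
by rewrite prodr_const; congr (_ ^+ _); apply: eq_card => k; rewrite !inE.
Qed.

(** The cycles over [O] contain [#|O| * orbit_mult w O] cards in all. In the even case each has
    length [#|O|], which gives their number. In the odd case at most one has length [#|O|] and the
    others twice that, so the parity and the half of the multiplicity count the two kinds. *)
Lemma prod_cycles_over w O : O \in porbits T ->
  \prod_(C in porbits (sg w) | ow w @: C == O) x #|C| =
  cycF x (odd_orbit neg O) #|O| (orbit_mult w O).
Proof.
move=> OT; pose D := [set C in porbits (sg w) | ow w @: C == O].
rewrite (eq_bigl (mem D)); last by move=> C; rewrite !inE.
have imC k : ow w @: porbit (sg w) k = porbit T (ow w k).
  apply/setP => p; apply/imsetP/porbitP => [[k' /porbitP[i ->] ->]|[i ->]].
    by exists i; rewrite rot_orbit_wordX.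
  by exists ((sg w ^+ i)%g k); rewrite ?mem_porbit // rot_orbit_wordX.
have DP C : reflect (exists2 k, C = porbit (sg w) k & O = porbit T (ow w k)) (C \in D).
  rewrite inE; apply: (iffP andP) => [[/imsetP[k _ ->] /eqP<-]|[k -> ->]].
    by exists k; rewrite ?imC.
  by rewrite imset_f ?imC.
have sumD : (\sum_(C in D) #|C| = #|O| * orbit_mult w O)%N.
  rewrite -card_over_orbit // -sum1dep_card.
  rewrite (partition_big (porbit (sg w)) (mem D)) /=.
    apply: eq_bigr => _ /DP[k -> ->]; rewrite -sum1_card; apply: eq_bigl => k'.
    rewrite eq_porbit_mem andb_idl // => kk'.
    rewrite -imC; exact: imset_f.
  move=> k kO; apply/DP; exists k => //.
  by case/imsetP: OT kO => q _ -> kq; apply/eqP; rewrite eq_sym eq_porbit_mem.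
have O0 : (0 < #|O|)%N.
  by case/imsetP: OT => q _ ->; apply/card_gt0P; exists q; apply: porbit_id.
rewrite /cycF; case: ifP => od; last first.
  have cD C : C \in D -> #|C| = #|O|.
    case/DP=> k -> EO; rewrite EO in od *.
    by case: (card_cycle neg key_inj w k) => // -[]; rewrite od.
  rewrite (eq_bigr (fun _ => x #|O|)) => [|C /cD-> //].
  rewrite prodr_const; congr (_ ^+ _); apply/eqP; rewrite -(eqn_pmul2l O0) -sumD.
  by rewrite mulnC -sum_nat_const; apply/eqP/eq_bigr => C /cD->.
pose D1 := [set C in D | #|C| == #|O|]; pose D2 := [set C in D | #|C| != #|O|].
have c2 C : C \in D2 -> #|C| = #|O|.*2.
  rewrite inE => /andP[/DP[k -> ->]].
  by case: (card_cycle neg key_inj w k) => [->|[_ ->]] //; rewrite eqxx.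
have D1le : (#|D1| <= 1)%N.
  apply/card_le1_eqP => C C'; rewrite !inE => /andP[HC /eqP E] /andP[HC' /eqP E'].
  have /DP[k Ek EO] : C \in D by rewrite inE.
  have /DP[k' Ek' EO'] : C' \in D by rewrite inE.
  rewrite Ek Ek'; apply: odd_short_cycle_uniq.
  - by rewrite -EO' EO porbit_id.
  - by rewrite -EO'.
  - by rewrite -Ek' -EO'.
  - by rewrite -Ek -EO'.
have sum12 : (orbit_mult w O = #|D1| + #|D2|.*2)%N.
  apply/eqP; rewrite -(eqn_pmul2l O0) -sumD (bigID (fun C : {set 'I_n} => #|C| == #|O|)) /=.
  have -> : (#|O| * (#|D1| + #|D2|.*2) = #|D1| * #|O| + #|D2| * #|O|.*2)%N.
    by rewrite -!muln2; ring.
  rewrite -!sum_nat_const; apply/eqP; congr (_ + _)%N.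
    by apply: eq_big => [C|C /andP[_ /eqP->]] //; rewrite !inE.
  apply: eq_big => [C|C CD]; first by rewrite !inE.
  by apply: c2; rewrite inE.
rewrite (bigID (fun C : {set 'I_n} => #|C| == #|O|)) /=; congr (_ * _).
  rewrite (eq_bigr (fun _ => x #|O|)); last by move=> C /andP[_ /eqP->].
  rewrite (eq_bigl (mem D1)); last by move=> C /=; rewrite !inE.
  rewrite prodr_const sum12 oddD odd_double addbF; congr (_ ^+ _).
  by case: #|D1| D1le => [|[|m]].
rewrite (eq_bigl (mem D2)); last by move=> C /=; rewrite !inE.
rewrite (eq_bigr (fun _ => x #|O|.*2)); last by move=> C /c2->.
rewrite prodr_const sum12 halfD odd_double andbF doubleK; congr (_ ^+ _).
by case: #|D1| D1le => [|[|m]].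
Qed.

Lemma word_weight w :
  \prod_k c (w k) * \prod_(C in porbits (std neg key_inj w)) x #|C| =
  \prod_(O in porbits T)
    (cycF x (odd_orbit neg O) #|O| (orbit_mult w O) * orbit_weight O ^+ orbit_mult w O).
Proof.
rewrite big_split mulrC /= -prod_letters; congr (_ * _).
rewrite -(porbitsV (std neg key_inj w)).
rewrite (partition_big (fun C : {set 'I_n} => ow w @: C) (mem (porbits T))) /=.
  by apply: eq_bigr => O; apply: prod_cycles_over.
move=> _ /imsetP[k _ ->]; apply/imsetP; exists (ow w k) => //.
apply/setP => p; apply/imsetP/porbitP => [[k' /porbitP[i ->] ->]|[i ->]].
  by exists i; rewrite rot_orbit_wordX.
by exists ((sg w ^+ i)%g k); rewrite ?mem_porbit // rot_orbit_wordX.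
Qed.

End Multiplicities.

(** * The signed Gessel-Reutenauer formula *)

Section GesselReutenauer.
Variables (A : finType) (key : A -> nat) (neg : A -> bool) (n : nat).
Hypothesis key_inj : injective key.
Local Notation T := (rot_perm A n).
Implicit Types (p q : periodic_word A n) (O : {set periodic_word A n}).

(** The words fixed by the [k]-th shift are the periodic extensions of words of length [k]; these
    have period [n!] because [k <= n] divides it. *)
Lemma sum_fixed (S : nmodType) k (F : {ffun 'I_k -> A} -> S) : (0 < k <= n)%N ->
  \sum_(p | (T ^+ k)%g p == p) F [ffun t : 'I_k => letter p t] = \sum_y F y.
Proof.
move=> /andP[k0 kn]; have kL : (k %| n`!)%N by rewrite dvdn_fact ?k0.
pose ext (y : {ffun 'I_k -> A}) : periodic_word A n :=
  [ffun i => y (Ordinal (ltn_pmod (nat_of_ord i) k0))].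
have letter_ext y j : letter (ext y) j = y (Ordinal (ltn_pmod j k0)).
  rewrite /ext (@letterE _ _ (fun i => y (Ordinal (ltn_pmod i k0)))) // => a b E.
  congr (y _); apply: val_inj => /=.
  by rewrite -(modn_dvdm a kL) E modn_dvdm.
rewrite (reindex_onto ext (fun p => [ffun t : 'I_k => letter p t])) /=; last first.
  move=> p /eqP fp; apply: letter_inj => j _; rewrite letter_ext ffunE /=.
  have H a : letter p (j %% k + a * k) = letter p (j %% k).
    elim: a => [|a IH]; first by rewrite addn0.
    by rewrite -IH mulSn addnCA addnC -letter_rot fp.
  by rewrite {2}(divn_eq j k) addnC H.
have E y : [ffun t : 'I_k => letter (ext y) t] = y.
  by apply/ffunP => t; rewrite ffunE letter_ext; congr (y _); apply: val_inj; rewrite /= modn_small.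
apply: eq_big => [y|y _]; last by rewrite E.
rewrite E eqxx andbT; apply/eqP/letter_inj => j _; rewrite letter_rot !letter_ext.
by congr (y _); apply: val_inj; rewrite /= modnDr.
Qed.

Section Weights.
Variables (S : comNzRingType) (x : nat -> S) (c : A -> S).

(** Sum over the possible multiplicities [j] of [O], with [u] marking the [#|O| * j] cards used. *)
Definition orbit_factor O : {poly S} :=
  (\poly_(j < n.+1) (cycF x (odd_orbit neg O) #|O| j * orbit_weight c O ^+ j))
    \Po 'X^#|O|.

Definition orbit_logder O : {poly S} :=
  ((\poly_(j < n.+1) (cycG x (odd_orbit neg O) #|O| j * orbit_weight c O ^+ j))
    *+ #|O|) \Po 'X^#|O|.

Lemma porbits_gt0 O : O \in porbits T -> (0 < #|O|)%N.
Proof. by case/imsetP=> q _ ->; apply/card_gt0P; exists q; apply: porbit_id. Qed.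

Lemma logderiv_orbits : logderiv n (\prod_(O in porbits T) orbit_factor O)
                                   (\sum_(O in porbits T) orbit_logder O).
Proof.
apply: logderiv_prod => O OT; apply: logderiv_comp; first exact: porbits_gt0.
by apply: logderiv_coefs => i _; apply: cycFG.
Qed.

Lemma orbit_factors_coef0 : (\prod_(O in porbits T) orbit_factor O)`_0 = 1.
Proof.
rewrite -horner_coef0 horner_prod; apply: big1 => O OT.
rewrite horner_coef0 coef_comp_poly_Xn ?porbits_gt0 // dvdn0 div0n coef_poly.
by rewrite /cycF /= !expr0 !mulr1; case: ifP.
Qed.

Lemma orbit_logder_coef0 : (\sum_(O in porbits T) orbit_logder O)`_0 = 0.
Proof.
rewrite coef_sum big1 // => O OT.
rewrite coef_comp_poly_Xn ?porbits_gt0 // dvdn0 div0n coefMn coef_poly.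
by rewrite /cycG /= mul0r mul0rn.
Qed.

(** The factor [#|O|] created by the substitution of [u^#|O|] turns the sum over orbits into a sum
    over their words; [#|O|] dividing [k] means that these are fixed by [T ^+ k]. *)
Lemma orbit_logder_coef k : (0 < k <= n)%N ->
  (\sum_(O in porbits T) orbit_logder O)`_k =
  \sum_(p | (T ^+ k)%g p == p)
     cycG x (odd_orbit neg (porbit T p)) #|porbit T p| (k %/ #|porbit T p|)
     * \prod_(t < k) c (letter p t).
Proof.
move=> /andP[k0 kn]; rewrite coef_sum [RHS]big_mkcond (big_porbits T) /=.
apply: eq_bigr => O OT; have O0 := porbits_gt0 OT.
rewrite coef_comp_poly_Xn //.
have eqO p : p \in O -> porbit T p = O.
  by case/imsetP: OT => q _ -> pq; apply/eqP; rewrite eq_porbit_mem.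
case: ifPn => dv; last first.
  by rewrite big1 // => p pO; rewrite perm_iter_fix eqO // (negbTE dv).
rewrite coefMn coef_poly ltnS (leq_trans (leq_div _ _) kn) -sumr_const.
apply: eq_bigr => p pO; rewrite perm_iter_fix eqO // dv; congr (_ * _).
have -> : \prod_(t < k) c (letter p t) = \prod_(t < #|O| * (k %/ #|O|)) c (letter p t).
  by rewrite mulnC divnK.
rewrite (@big_periodic _ _ _ (fun t => c (letter p t))); last first.
  by move=> t; rewrite -{1}(eqO _ pO) letter_periodic.
have -> : orbit_weight c O = \prod_(t < #|O|) c (letter p t).
  rewrite /orbit_weight -{1}(eqO _ pO) big_porbit eqO //.
  by apply: eq_bigr => t _; rewrite letter_rot.
by elim: (k %/ #|O|)%N => [|j IH]; rewrite ?expr0 // exprS IH.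
Qed.

Lemma orbit_factors_coef :
  (\prod_(O in porbits T) orbit_factor O)`_n =
  \sum_(f in pffun_on (ord0 : 'I_n.+1) (mem (porbits T)) predT
         | (\sum_(O in porbits T) #|O| * f O)%N == n)
     \prod_(O in porbits T)
        (cycF x (odd_orbit neg O) #|O| (f O) * orbit_weight c O ^+ f O).
Proof.
under eq_bigr do rewrite /orbit_factor comp_poly_Xn.
rewrite (big_distr_big (ord0 : 'I_n.+1)) /= coef_sum [RHS]big_mkcondr /=.
apply: eq_bigr => f _.
rewrite scaler_prod -expr_sum coefZ coefXn eq_sym.
by case: eqP => _; rewrite ?mulr1 ?mulr0.
Qed.

End Weights.

(** The value [ord0] off the orbits matches the functions indexing the expansion of a product of
    sums in [orbit_factors_coef]. *)
Definition orbit_mults (w : 'I_n -> A) : {ffun {set periodic_word A n} -> 'I_n.+1} :=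
  [ffun O => if O \in porbits T then inord (orbit_mult neg key_inj w O) else ord0].

Lemma orbit_multsE w O : O \in porbits T ->
  orbit_mults w O = orbit_mult neg key_inj w O :> nat.
Proof.
move=> OT; rewrite ffunE OT inordK // ltnS.
by rewrite (leq_trans (leq_div _ _)) // -[X in (_ <= X)%N](card_ord n) max_card.
Qed.

Lemma orbit_mults_inj (w w' : {ffun 'I_n -> A}) : orbit_mults w = orbit_mults w' -> w = w'.
Proof.
move=> E; apply/ffunP; apply: (@mult_inj _ _ neg _ key_inj) => p.
have pT : porbit T p \in porbits T by apply: imset_f.
rewrite !(orbit_multE _ _ _ pT) ?porbit_id //.
by rewrite -!orbit_multsE // E.
Qed.

Definition multiplicities : {set {ffun {set periodic_word A n} -> 'I_n.+1}} :=
  [set f in pffun_on (ord0 : 'I_n.+1) (mem (porbits T)) predT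
     | (\sum_(O in porbits T) #|O| * f O)%N == n].

(* Both sides satisfy the recursion [n c_n = \sum_(0 < k <= n) #|A|^k c_(n-k)], so the
   injection [orbit_mults] is a bijection. *)
Lemma card_multiplicities : #|multiplicities| = (#|A| ^ n)%N.
Proof.
(* With all variables and weights equal to [1], the product of the orbit factors counts
   [multiplicities]; working in [int] provides the cancellation required by [logderiv_uniq]. *)
pose one (S : comNzRingType) := fun _ : nat => 1 : S.
have F1 b l j : cycF (one int) b l j = 1 by rewrite /cycF !expr1n mulr1; case: b.
have G1 b l j : cycG (one int) b l j = (j != 0%N)%:R.
  rewrite /cycG; case: j => // j; rewrite !expr1n !mulr1 /=.
  case: b => //; rewrite -signr_odd /= negbK.
  by case: (odd j).
have inj k (a b : int) : a *+ k.+1 = b *+ k.+1 -> a = b.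
  by move=> /eqP; rewrite -subr_eq0 -mulrnBl mulrn_eq0 /= subr_eq0 => /eqP.
pose M := (#|A|%:R : int).
have LDM : logderiv n (\poly_(j < n.+1) M ^+ j)
                      (\poly_(j < n.+1) (if j == 0%N then 0 else M ^+ j)).
  apply: logderiv_coefs => i _; rewrite big_ord_recl /= mul0r add0r.
  rewrite (eq_bigr (fun _ => M ^+ i)); first by rewrite sumr_const card_ord.
  by move=> j _; rewrite -exprD subnKC //; have := ltn_ord j; rewrite /bump /=; lia.
have E : (\prod_(O in porbits T) orbit_factor (one int) (fun=> 1) O)`_n =
         (\poly_(j < n.+1) M ^+ j)`_n.
  apply: (logderiv_uniq inj (logderiv_orbits _ _) LDM (orbit_logder_coef0 _ _)) => //.
  - by rewrite coef_poly.
  - move=> k /andP[k0 kn]; rewrite orbit_logder_coef ?k0 // coef_poly ltnS kn.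
    rewrite -[k == 0%N]negbK -lt0n k0 /=.
    transitivity (\sum_(p | (T ^+ k)%g p == p) (1 : int)).
      apply: eq_bigr => p fp; rewrite G1 big1 // mulr1.
      rewrite -lt0n divn_gt0; last by apply/card_gt0P; exists p; apply: porbit_id.
      by rewrite dvdn_leq // -perm_iter_fix.
    rewrite (sum_fixed (fun _ : {ffun 'I_k -> A} => 1 : int)) ?k0 // sumr_const.
    by rewrite /M -natrX -[in RHS](card_ord k) -card_ffun.
  - by rewrite orbit_factors_coef0 coef_poly.
move: E; rewrite orbit_factors_coef coef_poly ltnSn /M -natrX.
rewrite (eq_bigr (fun _ => 1)); last first.
  by move=> f _; rewrite big1 // => O OT; rewrite F1 /orbit_weight big1 // expr1n mulr1.
rewrite (eq_bigl (mem multiplicities)); last by move=> f; rewrite !inE.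
by rewrite sumr_const => /eqP; rewrite eqr_nat => /eqP.
Qed.

(** Expanding the product of orbit factors gives a sum over multiplicity functions; [orbit_mults]
    matches these with words, and [word_weight] matches the summands. *)
Theorem gessel_reutenauer (S : comNzRingType) (x : nat -> S) (c : A -> S) :
  \sum_(w : {ffun 'I_n -> A})
     \prod_k c (w k) * \prod_(C in porbits (std neg key_inj w)) x #|C| =
  (\prod_(O in porbits T) orbit_factor x c O)`_n.
Proof.
pose h (w : {ffun 'I_n -> A}) := orbit_mults w.
have injh : injective h by move=> w w'; apply: orbit_mults_inj.
have Ed : [set h w | w in [set: {ffun 'I_n -> A}]] = multiplicities.
  apply/eqP; rewrite eqEcard card_imset // card_multiplicities cardsT card_ffun card_ord.
  rewrite leqnn andbT.
  apply/fintype.subsetP => _ /imsetP[w _ ->]; rewrite inE; apply/andP; split.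
    apply/pffun_onP; split=> //; apply/supportP => O OT.
    by rewrite ffunE (negbTE OT).
  rewrite -[X in _ == X](sum_orbit_mult neg key_inj w).
  by apply/eqP/eq_bigr => O OT; rewrite orbit_multsE.
rewrite orbit_factors_coef (eq_bigl (mem multiplicities)); last by move=> f; rewrite !inE.
rewrite -Ed big_imset /=; last by move=> w w' _ _; apply: injh.
apply: eq_big => [w|w _]; first by rewrite inE.
by rewrite word_weight; apply: eq_bigr => O OT; rewrite orbit_multsE.
Qed.

End GesselReutenauer.

(** * Moebius inversion for the contribution of one orbit *)

Section NecklaceCoefficients.
Variables (R : realType) (S : comAlgType R) (x : nat -> S).

(* [k] times the coefficient of [u^k] in the exponent of the right-hand side, for power
   sums [pt] and variables restricted to [x_1, ..., x_N]. *)
Definition cycle_logcoef (pt : nat -> R) N k : S :=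
  \sum_(i < N) \sum_(j < N | (i.+1 * j.+1 == k)%N)
    (\sum_(d <- divisors i.+1) moebius R d * pt (j.+1 * d)%N ^+ (i.+1 %/ d))
      *: x i.+1 ^+ j.+1.

Lemma sum_factor_pairs N k a (r : R) : (0 < k <= N)%N -> (0 < a)%N ->
  \sum_(i < N) \sum_(j < N | (i.+1 * j.+1 == k)%N)
     (r * (i.+1 == a)%:R) *: x i.+1 ^+ j.+1 =
  if (a %| k)%N then r *: x a ^+ (k %/ a) else 0.
Proof.
move=> /andP[k0 kN] a0; case: ifPn => [ak|nak].
  have aN : (a.-1 < N)%N by rewrite prednK // (leq_trans _ kN) // dvdn_leq.
  have qN : ((k %/ a).-1 < N)%N.
    by rewrite prednK ?divn_gt0 ?(dvdn_leq k0) // (leq_trans (leq_div _ _)).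
  rewrite (bigD1 (Ordinal aN)) //= prednK // [X in _ + X]big1 => [|i Hi]; last first.
    rewrite big1 // => j _; have -> : (i.+1 == a) = false.
      by apply: contraNF Hi => /eqP E; apply/eqP/val_inj; rewrite /= -E.
    by rewrite mulr0 scale0r.
  have q0 : (0 < k %/ a)%N by rewrite divn_gt0 ?(dvdn_leq k0).
  rewrite addr0 (bigD1 (Ordinal qN)) /=; last by rewrite !prednK // mulnC divnK.
  rewrite prednK // eqxx mulr1 big1 ?addr0 //.
  move=> j /andP[/eqP E]; rewrite -(inj_eq val_inj) /= => /eqP[].
  by rewrite -E mulKn.
rewrite big1 // => i _; rewrite big1 // => j /eqP E.
have -> : (i.+1 == a) = false.
  by apply: contraNF nak => /eqP<-; rewrite -E dvdn_mulr.
by rewrite mulr0 scale0r.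
Qed.

(** With [i = e * l], the condition on [d] says that [d] divides [e], and the exponent equals
    [e * j + e %/ d]. The first part leaves the sum as a common sign; the rest is [sum_moebius] or
    [sum_moebius_sign]. *)
Lemma sum_moebius_period (b : bool) l i j : (0 < l)%N -> (0 < i)%N ->
  \sum_(d <- divisors i | (l %| i %/ d)%N)
     moebius R d * ((-1) ^+ b) ^+ ((i %/ d %/ l) * (j * d).+1) =
  ((-1) ^+ b) ^+ (i * j %/ l) *
  (if b then - (i == l)%:R + (i == l.*2)%:R *+ 2 else (i == l)%:R).
Proof.
move=> l0 i0; case: (boolP (l %| i)%N) => [li|nli]; last first.
  have -> : (i == l) = false by apply: contraNF nli => /eqP->.
  have -> : (i == l.*2) = false.
    by apply: contraNF nli => /eqP->; rewrite -muln2 dvdn_mulr.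
  rewrite oppr0 mul0rn addr0 if_same mulr0 big_seq_cond big1 // => d /andP[].
  rewrite -dvdn_divisors // => di lid; case/negP: nli.
  by apply: dvdn_trans lid _; rewrite dvdn_div.
pose e := (i %/ l)%N; have Ei : i = (e * l)%N by rewrite divnK.
have e0 : (0 < e)%N by rewrite divn_gt0 // dvdn_leq.
rewrite -big_filter (perm_big (divisors e)) /=; last first.
  apply: uniq_perm; rewrite ?filter_uniq ?divisors_uniq // => d.
  rewrite mem_filter -!dvdn_divisors //; apply/andP/idP => [[H di]|de].
    by rewrite -(dvdn_pmul2r l0) -Ei -(divnK di) mulnC dvdn_pmul2r // (dvdn_gt0 i0).
  have di : (d %| i)%N by rewrite Ei dvdn_mulr.
  split=> //; rewrite -(@dvdn_pmul2r d) ?(dvdn_gt0 i0) // divnK // Ei mulnC.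
  by rewrite dvdn_pmul2r.
have -> : (i == l) = (e == 1)%N by rewrite Ei -{2}(mul1n l) eqn_pmul2r.
have -> : (i == l.*2) = (e == 2)%N by rewrite Ei -mul2n eqn_pmul2r.
have -> : (i * j %/ l = e * j)%N by rewrite Ei mulnAC mulnK.
transitivity (((-1) ^+ b) ^+ (e * j) *
    \sum_(d <- divisors e) moebius R d * ((-1) ^+ b) ^+ (e %/ d)).
  rewrite mulr_sumr big_seq [RHS]big_seq; apply: eq_bigr => d.
  rewrite -dvdn_divisors // => de; rewrite mulrCA -exprD; congr (_ * _ ^+ _).
  have d0 : (0 < d)%N by rewrite (dvdn_gt0 e0).
  have -> : (i %/ d %/ l = e %/ d)%N by rewrite -divnMA mulnC divnMA.
  by rewrite mulnS addnC mulnCA divnK // mulnC.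
congr (_ * _); case: b; first by rewrite expr1 sum_moebius_sign.
by rewrite expr0; under eq_bigr do rewrite expr1n mulr1; rewrite sum_moebius.
Qed.

(** Rewrites [cycG] in the shape of [cycle_logcoef]: after the Moebius sum only [i.+1 = l] and, for
    an odd orbit, [i.+1 = l.*2] survive, giving the two terms of [cycG]. *)
Lemma cycGE (b : bool) l k N : (0 < l)%N -> (0 < k <= N)%N ->
  \sum_(i < N) \sum_(j < N | (i.+1 * j.+1 == k)%N)
    (\sum_(d <- divisors i.+1 | (l %| i.+1 %/ d)%N)
        moebius R d * ((-1) ^+ b) ^+ ((i.+1 %/ d %/ l) * (j.+1 * d).+1))
      *: x i.+1 ^+ j.+1 =
  if (l %| k)%N then cycG x b l (k %/ l) else 0.
Proof.
move=> l0 kN; have /andP[k0 _] := kN.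
pose s : R := ((-1) ^+ b) ^+ (k %/ l).
transitivity (\sum_(i < N) \sum_(j < N | (i.+1 * j.+1 == k)%N)
   (((if b then - s else s) * (i.+1 == l)%:R) *: x i.+1 ^+ j.+1 +
    ((if b then s *+ 2 else 0) * (i.+1 == l.*2)%:R) *: x i.+1 ^+ j.+1)).
  apply: eq_bigr => i _; apply: eq_bigr => j /eqP E.
  rewrite sum_moebius_period // E -/s -scalerDl; congr (_ *: _).
  by case: (b); ring.
under eq_bigr do rewrite big_split.
rewrite big_split /= !sum_factor_pairs // ?double_gt0 //.
case: ifPn => [lk|nlk]; last first.
  rewrite add0r ifN //; apply: contra nlk; apply: dvdn_trans.
  by rewrite -muln2 dvdn_mulr.
rewrite /cycG /s {s}; have -> : (k %/ l == 0)%N = false.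
  by apply/negbTE; rewrite -lt0n divn_gt0 // dvdn_leq.
have kl2 : (l.*2 %| k)%N = ~~ odd (k %/ l).
  by rewrite -{1}(divnK lk) -mul2n dvdn_pmul2r // dvdn2.
case: b; last first.
  by rewrite expr0 expr1n scale1r scale0r if_same addr0.
rewrite expr1 kl2 exprS mulN1r -[in LHS]signr_odd -[in RHS]signr_odd.
case: (odd _) => /=.
  by rewrite !expr1 !opprK scale1r mul1r mul0r mul0rn.
have -> : (k %/ l.*2 = (k %/ l)./2)%N by rewrite -divn2 -divnMA muln2.
by rewrite !expr0 scaleN1r mulNr !mul1r scaler_nat.
Qed.

End NecklaceCoefficients.

(** * Power sums of a signed finite alphabet *)

Section PowerSums.
Variables (A : finType) (neg : A -> bool) (n : nat).
Variables (R : realType) (S : comAlgType R) (x : nat -> S) (c : A -> R).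
Local Notation T := (rot_perm A n).
Implicit Types (p : periodic_word A n).

(** The analogue of [ptilde] for a finite alphabet without the letter [0]: negative letters carry
    the sign [(-1) ^+ m.+1]. *)
Definition super_psum m : R := \sum_a ((-1) ^+ neg a) ^+ m.+1 * c a ^+ m.

Lemma super_psumX e m : (0 < e <= n)%N ->
  super_psum m ^+ e = \sum_(p | (T ^+ e)%g p == p)
    ((-1) ^+ odd_sign neg e p) ^+ m.+1 * \prod_(t < e * m) c (letter p t).
Proof.
move=> He; pose g a : R := ((-1) ^+ neg a) ^+ m.+1 * c a ^+ m.
transitivity (\prod_(t < e) \sum_a g a); first by rewrite prodr_const card_ord.
rewrite bigA_distr_bigA /= -(sum_fixed (n := n) (fun y => \prod_t g (y t))) //.
apply: eq_bigr => p /eqP fp; under eq_bigr do rewrite ffunE.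
rewrite big_split /= !prodrXl; congr (_ ^+ _ * _).
  by rewrite /odd_sign (big_morph _ (@signr_addb R) (erefl _)).
rewrite (@big_periodic _ _ _ (fun t => c (letter p t))) => [|t]; last first.
  by rewrite -letter_rot fp.
by elim: m {g} => [|m IH]; rewrite ?expr0 // exprS IH.
Qed.

Lemma odd_sign_period p e : (#|porbit T p| %| e)%N ->
  (-1) ^+ odd_sign neg e p =
  ((-1) ^+ odd_orbit neg (porbit T p)) ^+ (e %/ #|porbit T p|) :> R.
Proof.
move=> /divnK {1}<-; rewrite mulnC /odd_sign.
rewrite (@big_periodic _ _ _ (fun t => neg (letter p t))) => [|t]; last first.
  by rewrite letter_periodic.
rewrite -/(odd_sign neg _ p) odd_sign_orbit.
elim: (_ %/ _)%N => [|a IH]; first by rewrite expr0.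
by rewrite iterS signr_addb IH exprS.
Qed.

(** Expand each [cycG] by [cycGE] and exchange the sums. For fixed [i], [j], [d], the sum over
    periodic words is the expansion of a power of [super_psum] over the words fixed by
    [T ^+ (i.+1 %/ d)]. *)
Lemma logcoef_super_psum k : (0 < k <= n)%N ->
  \sum_(p | (T ^+ k)%g p == p)
     cycG x (odd_orbit neg (porbit T p)) #|porbit T p| (k %/ #|porbit T p|)
     * \prod_(t < k) (c (letter p t))%:A =
  cycle_logcoef x super_psum n k.
Proof.
move=> kn; have /andP[k0 kn'] := kn.
pose wt p := \prod_(t < k) c (letter p t).
have l0 p : (0 < #|porbit T p|)%N by apply/card_gt0P; exists p; apply: porbit_id.
transitivity (\sum_p wt p *: (if (#|porbit T p| %| k)%N
    then cycG x (odd_orbit neg (porbit T p)) #|porbit T p| (k %/ #|porbit T p|) else 0)).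
  rewrite big_mkcond; apply: eq_bigr => p _; rewrite perm_iter_fix.
  case: ifP => _; last by rewrite scaler0.
  rewrite mulrC; have -> : \prod_(t < k) (c (letter p t))%:A = (wt p)%:A :> S.
    by rewrite -in_algE /wt rmorph_prod.
  by rewrite mulr_algl.
under eq_bigr => p _ do rewrite -(cycGE x _ (l0 p) kn) scaler_sumr.
rewrite exchange_big; apply: eq_bigr => i _ /=.
under eq_bigr => p _ do rewrite scaler_sumr.
rewrite exchange_big; apply: eq_bigr => j /eqP Eij /=.
under eq_bigr => p _ do rewrite scalerA.
rewrite -scaler_suml; congr (_ *: _).
under [LHS]eq_bigr => p _ do rewrite mulr_sumr big_mkcond.
rewrite exchange_big big_seq [RHS]big_seq; apply: eq_bigr => d /=.
rewrite -dvdn_divisors // => di; have d0 : (0 < d)%N by rewrite (dvdn_gt0 _ di).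
have e0 : (0 < i.+1 %/ d)%N by rewrite divn_gt0 // dvdn_leq.
rewrite super_psumX ?e0 /=; last first.
  by rewrite (leq_trans (leq_div _ _)).
rewrite mulr_sumr [RHS]big_mkcond; apply: eq_bigr => p _; rewrite perm_iter_fix.
case: ifP => // le; rewrite odd_sign_period // mulrCA.
congr (_ * _); rewrite mulrC exprM; congr (_ * _).
have E : (i.+1 %/ d * (j.+1 * d) = k)%N by rewrite mulnCA divnK // mulnC.
by rewrite /wt E.
Qed.

End PowerSums.

(** * The cycle index of a finite alphabet *)

Section FiniteLimits.
Variables (R : realType) (I : Type) (P : pred I) (u : I -> nat -> R) (l : I -> R).
Local Open Scope classical_set_scope.
Hypothesis ul : forall i, P i -> u i @ \oo --> l i.

Lemma cvgr_sum (r : seq I) :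
  (fun K => \sum_(i <- r | P i) u i K) @ \oo --> \sum_(i <- r | P i) l i.
Proof.
elim: r => [|i r IH].
  by under eq_fun do rewrite big_nil; rewrite big_nil; apply: cvg_cst.
under eq_fun do rewrite big_cons; rewrite big_cons.
by case: ifP => // Pi; apply: cvgD => //; apply: ul.
Qed.

Lemma cvgr_prod (r : seq I) :
  (fun K => \prod_(i <- r | P i) u i K) @ \oo --> \prod_(i <- r | P i) l i.
Proof.
elim: r => [|i r IH].
  by under eq_fun do rewrite big_nil; rewrite big_nil; apply: cvg_cst.
under eq_fun do rewrite big_cons; rewrite big_cons.
by case: ifP => // Pi; apply: cvgM => //; apply: ul.
Qed.

End FiniteLimits.

Section CycleIndexSeries.
Variables (R : realType) (N : nat).
Local Notation S := {mpoly R[N]}.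

(** The variable [x_k], with default value [1] outside [1 <= k <= N]; cycles of a permutation in
    ['S_N] have lengths in this range. *)
Definition cycle_var (k : nat) : S := \prod_(i < N | k == i.+1) 'X_i.

Lemma cycle_varS (i : 'I_N) : cycle_var i.+1 = 'X_i.
Proof.
by rewrite /cycle_var (eq_bigl (pred1 i)) ?big_pred1_eq // => j; rewrite eqSS eq_sym.
Qed.

Lemma cycle_monomialE (s : 'S_N) :
  cycle_monomial R s = \prod_(C in porbits s) cycle_var #|C|.
Proof.
rewrite /cycle_var; under [RHS]eq_bigr do rewrite big_mkcond.
rewrite exchange_big; apply: eq_bigr => i _ /=.
by rewrite -big_mkcondr -prodr_const; apply: eq_bigl => C; rewrite !inE.
Qed.

Lemma natr_mpoly k : k%:R = (k%:R)%:MP :> S.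
Proof. by rewrite -[RHS]/(mpolyC _ _) rmorph_nat. Qed.

Lemma mulrn_mpoly_inj k (a b : S) : a *+ k.+1 = b *+ k.+1 -> a = b.
Proof.
have k0 : k.+1%:R != 0 :> R by rewrite pnatr_eq0.
by move=> E; rewrite -[a]scale1r -[b]scale1r -(mulVf k0) -!scalerA !scaler_nat E.
Qed.

Lemma invr_nat_mpoly k : (0 < k)%N -> (k%:R)^-1 = (k%:R^-1)%:MP :> S.
Proof.
move=> k0; apply: mulr1_eq; rewrite natr_mpoly -mpolyCM mulfV ?mpolyC1 //.
by rewrite pnatr_eq0 -lt0n.
Qed.

Lemma exp_trunc_comp m (a : S) : exp_trunc N ('X^m * a%:P) =
  (\poly_(j < N.+1) (((j`!)%:R^-1)%:MP * a ^+ j)) \Po 'X^m.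
Proof.
rewrite comp_poly_Xn; apply: eq_bigr => j _.
rewrite exprMn -rmorphXn -exprM mulrC mul_polyC scalerA; congr (_ *: _).
by rewrite invr_nat_mpoly ?fact_gt0.
Qed.

Lemma logderiv_exp_trunc m (a : S) : (0 < m)%N ->
  logderiv N (exp_trunc N ('X^m * a%:P))
    (((\poly_(j < N.+1) (if j == 1%N then a else 0)) *+ m) \Po 'X^m).
Proof.
move=> m0; rewrite exp_trunc_comp; apply: logderiv_comp => //.
apply: logderiv_coefs => -[|i] Hi; first by rewrite big_ord_recl big_ord0 mul0r addr0.
rewrite big_ord_recl big_ord_recl /= mul0r add0r big1 ?addr0; last first.
  by move=> j _; rewrite mul0r.
rewrite /bump /= subSS subn0 mulrCA -exprS -mulrnAl -rmorphMn; congr (_%:MP * _).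
by rewrite factS natrM invfM -mulr_natr mulrAC mulVf ?mul1r // pnatr_eq0.
Qed.

Definition exp_coef (pt : nat -> R) i j : R :=
  ((i.+1 * j.+1)%:R)^-1 *
    \sum_(d <- divisors i.+1) moebius R d * pt (j.+1 * d)%N ^+ (i.+1 %/ d).

Definition cycle_series (pt : nat -> R) : {poly S} :=
  \prod_(i < N) \prod_(j < N)
    exp_trunc N ('X^(i.+1 * j.+1) * ('X_i ^+ j.+1 * (exp_coef pt i j)%:MP)%:P).

Definition cycle_series_logder (pt : nat -> R) : {poly S} :=
  \sum_(i < N) \sum_(j < N)
    (((\poly_(k < N.+1) (if k == 1%N then 'X_i ^+ j.+1 * (exp_coef pt i j)%:MP else 0))
        *+ (i.+1 * j.+1)) \Po 'X^(i.+1 * j.+1)).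

Lemma logderiv_cycle_series pt :
  logderiv N (cycle_series pt) (cycle_series_logder pt).
Proof. by do 2![apply: logderiv_prod => ? _]; apply: logderiv_exp_trunc. Qed.

Lemma cycle_series_coef0 pt : (cycle_series pt)`_0 = 1.
Proof.
rewrite -horner_coef0 horner_prod big1 // => i _; rewrite horner_prod big1 // => j _.
rewrite horner_coef0 exp_trunc_comp coef_comp_poly_Xn // dvdn0 div0n coef_poly /=.
by rewrite expr0 mulr1 invr1 mpolyC1.
Qed.

Lemma cycle_series_logder_coef0 pt : (cycle_series_logder pt)`_0 = 0.
Proof.
rewrite coef_sum big1 // => i _; rewrite coef_sum big1 // => j _.
by rewrite coef_comp_poly_Xn // dvdn0 div0n coefMn coef_poly /= mul0rn.
Qed.

Lemma cycle_series_logder_coef pt k : (0 < k <= N)%N ->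
  (cycle_series_logder pt)`_k = cycle_logcoef cycle_var pt N k.
Proof.
move=> /andP[k0 kN]; rewrite coef_sum; apply: eq_bigr => i _.
rewrite coef_sum [RHS]big_mkcond; apply: eq_bigr => j _ /=.
rewrite coef_comp_poly_Xn //; set m := (i.+1 * j.+1)%N.
have m0 : (0 < m)%N by [].
case: (m =P k) => [<-|mk].
  rewrite dvdnn divnn m0 /= coefMn coef_poly /= ltnS (leq_trans k0 kN).
  rewrite cycle_varS /exp_coef -/m mulrC mul_mpolyC -scaler_nat scalerA mulrA.
  by rewrite mulfV ?mul1r // pnatr_eq0 -lt0n.
case: ifP => // mdk; rewrite coefMn coef_poly.
have -> : (k %/ m == 1)%N = false.
  by apply/eqP => E; apply: mk; rewrite -(divnK mdk) E mul1n.
by rewrite if_same mul0rn.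
Qed.

(** Solved form of the logarithmic derivative equation, through which limits in the power sums pass
    to the coefficients. *)
Lemma cycle_series_rec pt i : (i < N)%N ->
  (cycle_series pt)`_i.+1 = (i.+1%:R^-1 : R) *:
    \sum_(j < i.+1) cycle_logcoef cycle_var pt N j.+1 * (cycle_series pt)`_(i - j).
Proof.
move=> iN; apply: (@mulrn_mpoly_inj i); rewrite -[in RHS]scaler_nat scalerA.
rewrite mulfV ?scale1r ?pnatr_eq0 // -coefXderiv logderiv_cycle_series //.
rewrite coefM big_ord_recl cycle_series_logder_coef0 mul0r add0r.
apply: eq_bigr => j _; rewrite !lift0 subSS cycle_series_logder_coef //.
by rewrite (leq_trans (ltn_ord j)).
Qed.

Lemma rhs_coefE alpha beta gamma :
  rhs_coef alpha beta gamma N = (cycle_series (ptilde alpha beta gamma))`_N.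
Proof. by []. Qed.

(** By [gessel_reutenauer] the left side is a coefficient of the product of orbit factors. That
    product and [cycle_series] have constant term [1] and logarithmic derivatives agreeing up to
    degree [N]. *)
Theorem finite_cycle_index (A : finType) (key : A -> nat) (neg : A -> bool)
    (key_inj : injective key) (c : A -> R) :
  \sum_(w : {ffun 'I_N -> A})
    (\prod_k c (w k)) *: cycle_monomial R (std neg key_inj w) =
  (cycle_series (super_psum neg c))`_N.
Proof.
transitivity (\sum_(w : {ffun 'I_N -> A}) \prod_k (c (w k))%:A *
    \prod_(C in porbits (std neg key_inj w)) cycle_var #|C|).
  apply: eq_bigr => w _; rewrite cycle_monomialE -mulr_algl; congr (_ * _).
  by rewrite -in_algE rmorph_prod.
rewrite (gessel_reutenauer neg N key_inj cycle_var (fun a => (c a)%:A : S)).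
apply: (logderiv_uniq mulrn_mpoly_inj (logderiv_orbits _ _ _)
  (logderiv_cycle_series (super_psum neg c))) => //.
- exact: orbit_logder_coef0.
- exact: cycle_series_logder_coef0.
- move=> k kN; rewrite orbit_logder_coef // cycle_series_logder_coef //.
  exact: logcoef_super_psum.
- by rewrite orbit_factors_coef0 cycle_series_coef0.
Qed.

Local Open Scope classical_set_scope.

(** Coefficientwise convergence, which reduces limits of polynomials to limits in [R]. *)
Definition cvg_mpoly (u : nat -> S) (l : S) :=
  forall m : 'X_{1..N}, (fun K => (u K)@_m) @ \oo --> l@_m.

Lemma cvg_mpoly_unique u l l' : cvg_mpoly u l -> cvg_mpoly u l' -> l = l'.
Proof.
move=> H H'; apply/mpolyP => m.
by apply: (cvg_unique _ (H m) (H' m)); exact: Rhausdorff.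
Qed.

Lemma cvg_mpoly_cst l : cvg_mpoly (fun=> l) l.
Proof. by move=> m; apply: cvg_cst. Qed.

Lemma cvg_mpoly_sum (I : Type) (r : seq I) (P : pred I) (u : I -> nat -> S) (l : I -> S) :
  (forall i, P i -> cvg_mpoly (u i) (l i)) ->
  cvg_mpoly (fun K => \sum_(i <- r | P i) u i K) (\sum_(i <- r | P i) l i).
Proof.
move=> H m.
rewrite (_ : (fun K => _) = (fun K => \sum_(i <- r | P i) (u i K)@_m)); last first.
  by apply/funext => K; rewrite raddf_sum.
by rewrite raddf_sum; apply: cvgr_sum => i Pi; apply: H.
Qed.

Lemma cvg_mpolyZ (a : nat -> R) (b : R) u l :
  a @ \oo --> b -> cvg_mpoly u l -> cvg_mpoly (fun K => a K *: u K) (b *: l).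
Proof.
move=> ab H m; under eq_fun do rewrite mcoeffZ; rewrite mcoeffZ.
by apply: cvgM => //; apply: H.
Qed.

Lemma cvg_mpolyM u l u' l' : cvg_mpoly u l -> cvg_mpoly u' l' ->
  cvg_mpoly (fun K => u K * u' K) (l * l').
Proof.
move=> H H' m; under eq_fun do rewrite mcoeffM; rewrite mcoeffM.
by apply: cvgr_sum => k _; apply: cvgM; [apply: H | apply: H'].
Qed.

Lemma cvg_cycle_series (pt : nat -> nat -> R) (q : nat -> R) :
  (forall m, (0 < m)%N -> (fun K => pt K m) @ \oo --> q m) ->
  forall i, (i <= N)%N ->
    cvg_mpoly (fun K => (cycle_series (pt K))`_i) (cycle_series q)`_i.
Proof.
move=> H; elim/ltn_ind => -[_ _|i IH Hi].
  under eq_fun do rewrite cycle_series_coef0.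
  by rewrite cycle_series_coef0; apply: cvg_mpoly_cst.
rewrite [X in cvg_mpoly _ X](cycle_series_rec q Hi).
under eq_fun => K do rewrite (cycle_series_rec (pt K) Hi).
apply: (cvg_mpolyZ (a := fun=> i.+1%:R^-1 : R)).
  exact: cvg_cst.
apply: cvg_mpoly_sum => j _; apply: cvg_mpolyM; last first.
  by apply: IH; rewrite ?ltnS ?leq_subr // (leq_trans (leq_subr _ _)) // ltnW.
apply: cvg_mpoly_sum => a _; apply: cvg_mpoly_sum => b _.
apply: cvg_mpolyZ; last exact: cvg_mpoly_cst.
under eq_fun do rewrite big_seq; rewrite big_seq.
apply: cvgr_sum => d; rewrite -dvdn_divisors // => da; apply: cvgM; first exact: cvg_cst.
have d0 : (0 < b.+1 * d)%N by rewrite muln_gt0 (dvdn_gt0 _ da).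
elim: (_ %/ _)%N => [|e IHe]; first by under eq_fun do rewrite expr0; apply: cvg_cst.
by under eq_fun do rewrite exprS; rewrite exprS; apply: cvgM => //; apply: H.
Qed.

End CycleIndexSeries.

(** * Shuffles and reversal *)

Section ShufflePermutations.
Variable n : nat.
Implicit Types (w : 'I_n -> int) (tau pi : 'S_n).

Definition shuffle_lt w tau : rel 'I_n := fun q p =>
  (w q < w p) || ((w q == w p) &&
     (if 0 < w p then (q < p)%N else if w p < 0 then (p < q)%N else (tau q < tau p)%N)).

Lemma shuffle_total w tau : strict_total (shuffle_lt w tau).
Proof.
rewrite /shuffle_lt; split=> [p|q p r|p q pq].
- by rewrite !ltxx eqxx /= !ltnn !if_same.
- move=> /orP[H1|/andP[/eqP H1 H1']] /orP[H2|/andP[/eqP H2 H2']].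
  + by rewrite (lt_trans H1 H2).
  + by rewrite -H2 H1.
  + by rewrite H1 H2.
  + rewrite H1 H2 eqxx ltxx /=; rewrite H2 in H1'.
    by move: H1' H2'; case: ifP => _; [lia|case: ifP => _; lia].
- case: ltgtP => //= E; rewrite E.
  have tpq : tau p != tau q by rewrite (inj_eq perm_inj).
  by move: pq tpq; rewrite !neq_ltn; case: ifP => _; [|case: ifP => _]; rewrite // orbC.
Qed.

Definition shuffle_perm w tau : 'S_n := rank_perm (shuffle_total w tau).

Lemma shuffle_valE w tau p : shuffle_val w tau p = shuffle_perm w tau p.
Proof.
rewrite rank_permE /rank /shuffle_val /shuffle_lt -cardsUI.
rewrite [X in (_ + X)%N](_ : _ = 0%N) ?addn0; last first.
  apply: eq_card0 => q; rewrite !inE.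
  by case: eqP => [->|_]; rewrite ?ltxx ?andbF.
by apply: eq_card => q; rewrite !inE.
Qed.

Lemma card_shuffle_val w pi :
  #|[set tau : 'S_n | [forall p, (pi p : nat) == shuffle_val w tau p]]| =
  #|[set tau : 'S_n | shuffle_perm w tau == pi]|.
Proof.
apply: eq_card => tau; rewrite !inE.
apply/forallP/eqP => [H|<- p]; last by rewrite shuffle_valE.
by apply/permP => p; apply: val_inj; rewrite /= -shuffle_valE; apply/esym/eqP.
Qed.

Lemma rank_converse (lt lt' : rel 'I_n) p : strict_total lt ->
  (forall q r, lt' q r = lt r q) -> rank lt' p = (n - (rank lt p).+1)%N.
Proof.
move=> [irr tr tot] E; rewrite /rank.
have -> : [set q | lt' q p] = ~: (p |: [set q | lt q p]).
  apply/setP => q; rewrite !inE E negb_or.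
  case: (eqVneq q p) => [->|/tot qp]; first by rewrite irr.
  apply/idP/idP => [pq|/negbTE nqp]; last by rewrite nqp in qp.
  by apply/negP => qp'; have := tr _ _ _ qp' pq; rewrite irr.
by rewrite cardsCs finset.setCK cardsU1 inE irr card_ord.
Qed.

Lemma w0E (i : 'I_n) : w0 n i = rev_ord i.
Proof. by rewrite permE. Qed.

(** Negating the letters reverses the order of the blocks and exchanges increasing with decreasing
    ones; composing [tau] with [w0] reverses the [0]-block too. The whole comparison is thus
    reversed, and rank [r] becomes [n - r.+1]. *)
Lemma shuffle_perm_opp w tau :
  shuffle_perm (fun q => - w q) (tau * w0 n) = (shuffle_perm w tau * w0 n)%g.
Proof.
apply/permP => p; apply: val_inj; rewrite permM w0E /= !rank_permE.
apply: rank_converse; first exact: shuffle_total.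
move=> q r; rewrite /shuffle_lt ltrN2 eqr_opp eq_sym oppr_gt0 oppr_lt0.
congr (_ || _); case: eqP => //= E; rewrite E.
case: ltgtP => // _; rewrite !permM !w0E /=.
by have := ltn_ord (tau r); have := ltn_ord (tau q); lia.
Qed.

End ShufflePermutations.

Section Reversal.
Variables (R : realType) (alpha beta : nat -> R) (gamma : R) (n : nat).

Lemma letter_prob_opp z : letter_prob beta alpha gamma (- z) = letter_prob alpha beta gamma z.
Proof. by rewrite /letter_prob oppr_gt0 oppr_lt0 abszN; case: ltgtP. Qed.

Lemma shuffle_prob_trunc_opp (pi : 'S_n) K :
  shuffle_prob_trunc beta alpha gamma (pi * w0 n) K =
  shuffle_prob_trunc alpha beta gamma pi K.
Proof.
(* Letters are stored shifted by [K], so [rev_ord], which sends [a] to [K.*2 - a], is negation. *)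
pose h (w : {ffun 'I_n -> 'I_(K.*2.+1)}) := [ffun p => rev_ord (w p)].
have hK : involutive h by move=> w; apply/ffunP => p; rewrite !ffunE rev_ordK.
rewrite /shuffle_prob_trunc (reindex_inj (inv_inj hK)); apply: eq_bigr => w _.
have E p : (h w p)%:Z - K%:Z = - ((w p)%:Z - K%:Z).
  rewrite ffunE /= subSS; have := ltn_ord (w p); set a := nat_of_ord _ => Ha; lia.
congr (_ * (_%:R / _)).
  by apply: eq_bigr => p _; rewrite E letter_prob_opp.
rewrite !card_shuffle_val.
(* Count the auxiliary orders after the bijection [tau -> tau * w0]. *)
rewrite -[LHS](card_preimset _ (mulIg (w0 n))); apply: eq_card => tau; rewrite !inE.
set w' := (fun q : 'I_n => (w q)%:Z - K%:Z).
have -> : (fun q : 'I_n => (h w q)%:Z - K%:Z) = (fun q => - w' q) by apply/funext => q.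
by rewrite shuffle_perm_opp (inj_eq (mulIg _)).
Qed.

(** [t * s] is the conjugate of [s * t] by [s], and [s] maps the cycles of one onto those of the
    other. *)
Lemma cycle_monomial_conj (s t : 'S_n) :
  cycle_monomial R (s * t)%g = cycle_monomial R (t * s)%g.
Proof.
rewrite !cycle_monomialE.
have -> : (t * s = (s * t) ^ s)%g by rewrite conjgE mulgA mulKg.
have cyc x : porbit ((s * t) ^ s)%g (s x) = s @: porbit (s * t)%g x.
  apply/setP => y; apply/porbitP/imsetP => [[i ->]|[_ /porbitP[i ->] ->]].
    by exists (((s * t) ^+ i)%g x); rewrite ?mem_porbit // -conjXg conjgE !permM permK.
  by exists i; rewrite -conjXg conjgE !permM permK.
have inj : injective (fun C : {set 'I_n} => s @: C) by apply: imset_inj; apply: perm_inj.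
have -> : porbits ((s * t) ^ s)%g = [set s @: (C : {set 'I_n}) | C in porbits (s * t)%g].
  apply/setP => C; apply/imsetP/imsetP => [[x _ ->]|[_ /imsetP[x _ ->] ->]].
    exists (porbit (s * t)%g ((s^-1)%g x)); first exact: imset_f.
    by rewrite -cyc permKV.
  by exists (s x); rewrite ?cyc.
rewrite [RHS]big_imset /=; last by move=> C D _ _ /inj.
by apply: eq_bigr => C _; rewrite card_imset //; apply: perm_inj.
Qed.

Lemma Ecyc_revE : Ecyc_rev alpha beta gamma n = Ecyc beta alpha gamma n.
Proof.
rewrite /Ecyc [RHS](reindex_inj (mulIg (w0 n))); apply: eq_bigr => pi _.
rewrite /reverse_cards cycle_monomial_conj; congr (_ *: _).
by rewrite /shuffle_prob; congr (limn _); apply/funext => K; rewrite shuffle_prob_trunc_opp.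
Qed.

End Reversal.

(** * Passing to the limit *)

Lemma sum_words_pushforward (R : comNzRingType) (V : lmodType R) (A B : finType) n
    (phi : A -> B) (g : A -> R) (F : {ffun 'I_n -> B} -> V) :
  \sum_(w : {ffun 'I_n -> A}) (\prod_k g (w k)) *: F [ffun k => phi (w k)] =
  \sum_(v : {ffun 'I_n -> B}) (\prod_k \sum_(a | phi a == v k) g a) *: F v.
Proof.
rewrite (partition_big (fun w : {ffun 'I_n -> A} => [ffun k => phi (w k)]) xpredT) //=.
apply: eq_bigr => v _; rewrite bigA_distr_big_dep /= scaler_suml.
apply: eq_big => [w|w /eqP-> //].
apply/eqP/familyP => [<- k|H]; first by rewrite unfold_in ffunE.
by apply/ffunP => k; rewrite ffunE; apply/eqP; have := H k; rewrite unfold_in.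
Qed.

(** * Uniform random order from independent labels *)

Section UniformOrder.
Variables (R : realType) (n : nat).

Lemma val_ord_inj M : injective (@nat_of_ord M).
Proof. exact: val_inj. Qed.

Definition pattern M (r : 'I_n -> 'I_M) : 'S_n := std (fun=> false) (@val_ord_inj M) r.

Lemma pattern_lt M (r : 'I_n -> 'I_M) p q :
  (pattern r q < pattern r p)%N = (r q < r p)%N || ((r q == r p) && (q < p)%N).
Proof. by rewrite rank_perm_lt. Qed.

Definition injective_words M tau := [set r : {ffun 'I_n -> 'I_M} | injectiveb r & pattern r == tau].

Lemma pattern_comp M (r : {ffun 'I_n -> 'I_M}) (g : 'S_n) : injective r ->
  pattern [ffun p => r (g p)] = (g * pattern r)%g.
Proof.
move=> rinj; apply/permP => p; apply: val_inj; rewrite permM /= !rank_permE.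
rewrite -[RHS](card_preimset _ (@perm_inj _ g)); apply: eq_card => q; rewrite !inE.
rewrite /std_lt !ffunE; congr (_ || _).
rewrite !(inj_eq rinj) (inj_eq perm_inj).
by case: eqP => [->|//]; rewrite !ltnn.
Qed.

(** Permuting positions by [t * s^-1] turns an injective word of pattern [s] into one of pattern
    [t]. Exchanging [s] and [t] then yields equality. *)
Lemma card_injective_words_le M (s t : 'S_n) :
  (#|injective_words M s| <= #|injective_words M t|)%N.
Proof.
pose h (r : {ffun 'I_n -> 'I_M}) := [ffun p => r ((t * s^-1)%g p)].
have hinj : injective h.
  move=> r r' /ffunP E; apply/ffunP => p.
  by have := E ((t * s^-1)^-1%g p); rewrite !ffunE permKV.
rewrite -(card_imset _ hinj); apply: subset_leq_card; apply/fintype.subsetP.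
move=> _ /imsetP[r + ->]; rewrite !inE => /andP[/injectiveP ri /eqP E].
rewrite pattern_comp // E mulgKV eqxx andbT; apply/injectiveP => p q.
by rewrite !ffunE => /ri/perm_inj.
Qed.

Lemma card_injective_words M (tau : 'S_n) : (n`! * #|injective_words M tau| = M ^_ n)%N.
Proof.
have := card_inj_ffuns 'I_n 'I_M; rewrite !card_ord => <-.
rewrite -[RHS]sum1_card [RHS](partition_big (fun r : {ffun 'I_n -> 'I_M} => pattern r) xpredT) //=.
rewrite -card_Sn -sum_nat_const; apply: eq_big => // s _.
rewrite sum1dep_card; transitivity #|injective_words M s|.
  by apply/eqP; rewrite eqn_leq !card_injective_words_le.
by apply: eq_card => r; rewrite !inE.
Qed.

Definition pattern_freq M (tau : 'S_n) : R :=
  #|[set r : {ffun 'I_n -> 'I_M.+1} | pattern r == tau]|%:R / M.+1%:R ^+ n.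

Local Open Scope classical_set_scope.

Lemma cvg_ffact_ratio :
  (fun M => (M.+1 ^_ n)%:R / M.+1%:R ^+ n : R) @ \oo --> (1 : R).
Proof.
rewrite [X in _ --> X](_ : 1 = \prod_(i < n) (1 : R)); last by rewrite big1.
rewrite (_ : (fun M => _) = (fun M => \prod_(i < n) ((M.+1 - i)%N%:R / M.+1%:R))); last first.
  apply/funext => M; rewrite ffact_prod natr_prod big_split /=; congr (_ * _).
  by rewrite prodr_const card_ord exprVn.
apply: cvgr_prod => i _.
(* The lower bound also holds for [i > M.+1], where the truncated subtraction gives [0]. *)
apply: (@squeeze_cvgr _ _ _ _ (fun M => 1 - i%:R * @harmonic R M) (fun=> 1)).
- near=> M; have M0 : (0 : R) < M.+1%:R by rewrite ltr0n.
  rewrite ler_pdivlMr // ler_pdivrMr // mul1r ler_nat leq_subr andbT.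
  rewrite mulrBl mul1r -mulrA mulVf ?gt_eqF // mulr1 lerBlDr -natrD ler_nat.
  by lia.
- rewrite -[X in _ --> X]subr0 -[X in _ --> _ - X](mulr0 i%:R).
  by apply: cvgB; [exact: cvg_cst | apply: cvgM; [exact: cvg_cst | exact: cvg_harmonic]].
- exact: cvg_cst.
Unshelve. all: by end_near.
Qed.

(* All but a vanishing proportion of the words are injective, and by symmetry the injective
   words are equidistributed among the patterns. *)
Lemma cvg_pattern_freq tau : (fun M => pattern_freq M tau) @ \oo --> (n`!%:R^-1 : R).
Proof.
pose y M : R := (M.+1 ^_ n)%:R / M.+1%:R ^+ n.
have f0 : (n`!%:R : R) != 0 by rewrite pnatr_eq0 -lt0n fact_gt0.
(* Below: only the injective words of pattern [tau]. Above: these together with all non-injective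
   words, of proportion [1 - y M]. *)
apply: (@squeeze_cvgr _ _ _ _ (fun M => y M * n`!%:R^-1)
  (fun M => y M * n`!%:R^-1 + (1 - y M))).
- near=> M.
  have P0 : (0 : R) < M.+1%:R ^+ n by rewrite exprn_gt0 // ltr0n.
  have E : y M * n`!%:R^-1 = #|injective_words M.+1 tau|%:R / M.+1%:R ^+ n.
    by rewrite /y -(card_injective_words _ tau) natrM mulrC !mulrA mulVf // mul1r.
  pose W := [set r : {ffun 'I_n -> 'I_M.+1} | pattern r == tau]%SET.
  pose J := [set r : {ffun 'I_n -> 'I_M.+1} | injectiveb r]%SET.
  have IW : injective_words M.+1 tau = (W :&: J)%SET.
    by apply/setP => r; rewrite !inE andbC.
  rewrite E /pattern_freq -/W ler_pM2r ?invr_gt0 // ler_nat.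
  rewrite IW subset_leq_card ?finset.subsetIl //=.
  have -> : 1 - y M = (M.+1 ^ n - M.+1 ^_ n)%N%:R / M.+1%:R ^+ n.
    rewrite /y natrB ?natrX ?mulrBl ?mulfV ?gt_eqF //.
    have := card_inj_ffuns 'I_n 'I_M.+1; rewrite !card_ord => <-.
    by rewrite (leq_trans (max_card _)) // card_ffun !card_ord.
  rewrite -mulrDl ler_pM2r ?invr_gt0 // -natrD ler_nat -(cardsID J W) leq_add2l.
  have := card_inj_ffuns 'I_n 'I_M.+1; rewrite !card_ord => <-.
  have -> : (M.+1 ^ n = #|{ffun 'I_n -> 'I_M.+1}|)%N by rewrite card_ffun !card_ord.
  rewrite -(cardsC J) addKn.
  by apply: subset_leq_card; apply/fintype.subsetP => r; rewrite !inE => /andP[].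
- rewrite -[X in _ --> X]mul1r; apply: cvgM; last exact: cvg_cst.
  exact: cvg_ffact_ratio.
- rewrite -[X in _ --> X]addr0 -[X in _ --> X + _]mul1r -[X in _ --> _ + X](subrr 1).
  apply: cvgD; first by apply: cvgM; [exact: cvg_ffact_ratio | exact: cvg_cst].
  by apply: cvgB; [exact: cvg_cst | exact: cvg_ffact_ratio].
Unshelve. all: by end_near.
Qed.

End UniformOrder.

(** * The letter [0] as a limit of many light letters *)

Section RefinedAlphabet.
Variables (R : realType) (alpha beta : nat -> R) (gamma : R) (n K : nat).
Local Notation lp a := (letter_prob alpha beta gamma ((nat_of_ord a)%:Z - K%:Z)).

(* The letter [0] is split into [M.+1] ordered copies of weight [gamma / M.+1]; the copies
   [(a, r)] with [r != 0] of a nonzero letter [a] have weight [0]. *)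
Definition refined M := ('I_(K.*2.+1) * 'I_M.+1)%type.
Definition refined_key M (b : refined M) := (b.1 * M.+1 + b.2)%N.
Definition refined_neg M (b : refined M) := (b.1 < K)%N.
Definition refine M (b : refined M) : refined M :=
  if b.1 == K :> nat then b else (b.1, ord0).
Definition refined_weight M (b : refined M) : R :=
  \sum_(b' | refine b' == b) lp b'.1 / M.+1%:R.

Lemma refined_key_inj M : injective (@refined_key M).
Proof.
move=> [a r] [a' r']; rewrite /refined_key /= => E.
have E1 := congr1 (fun m => m %/ M.+1)%N E; have E2 := congr1 (fun m => m %% M.+1)%N E.
rewrite !divnMDl // !divn_small // !addn0 in E1; rewrite !modnMDl !modn_small // in E2.
by congr (_, _); apply: val_inj.
Qed.

Lemma refined_weightE M (b : refined M) : refined_weight b =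
  if b.1 == K :> nat then gamma / M.+1%:R else if b.2 == ord0 then lp b.1 else 0.
Proof.
case: b => a r; rewrite /refined_weight /=.
case: eqP => [aK|/eqP aK].
  rewrite (big_pred1 (a, r)) /= ?aK ?subrr // => -[a' r']; rewrite /refine /=.
  case: (nat_of_ord a' =P K) => [//|aK']; rewrite !xpair_eqE; have -> // : (a' == a) = false.
  by apply/eqP => E; rewrite E in aK'.
case: eqP => [->|/eqP r0]; last first.
  rewrite big1 // => -[a' r']; rewrite /refine /=; case: (nat_of_ord a' =P K) => [aK'|_].
    by rewrite xpair_eqE => /andP[/eqP E]; rewrite E in aK'; rewrite aK' eqxx in aK.
  by rewrite xpair_eqE => /andP[_]; rewrite eq_sym (negbTE r0).
transitivity (\sum_(r' < M.+1) lp a / M.+1%:R); last first.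
  by rewrite sumr_const card_ord -[LHS]mulr_natr mulfVK // pnatr_eq0.
rewrite (reindex_onto (fun r' : 'I_M.+1 => (a, r')) snd) /=; last first.
  move=> [a' r'] /=; rewrite /refine /=; case: (nat_of_ord a' =P K) => [aK'|_].
    by rewrite xpair_eqE => /andP[/eqP E]; rewrite E in aK'; rewrite aK' eqxx in aK.
  by rewrite xpair_eqE => /andP[/eqP-> _].
by apply: eq_bigl => r'; rewrite /refine /= (negbTE aK) !eqxx.
Qed.

(** Zero letters are compared by their labels, then left to right, which is the order of
    [pattern r]. Other letters forget their labels under [refine], so ties are settled by sign and
    position. *)
Lemma refined_std M (w : 'I_n -> 'I_(K.*2.+1)) (r : 'I_n -> 'I_M.+1) :
  std (@refined_neg M) (@refined_key_inj M) (fun k => refine (w k, r k)) =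
  shuffle_perm (fun q => (w q)%:Z - K%:Z) (pattern r).
Proof.
apply: eq_rank_perm => q p; rewrite /std_lt /shuffle_lt pattern_lt /refined_neg /refined_key.
have ref1 (b : refined M) : (refine b).1 = b.1 by rewrite /refine; case: ifP.
rewrite !ref1 /=.
have -> : ((w q)%:Z - K%:Z < (w p)%:Z - K%:Z) = (w q < w p)%N by rewrite ltrD2r.
have -> : ((w q)%:Z - K%:Z == (w p)%:Z - K%:Z) = (w q == w p) by rewrite (inj_eq (addIr _)).
have -> : (0 < (w p)%:Z - K%:Z) = (K < w p)%N by rewrite subr_gt0.
have -> : ((w p)%:Z - K%:Z < 0) = (w p < K)%N by rewrite subr_lt0.
have key_lt (a a' b b' : nat) : (a < a')%N -> (b < M.+1)%N ->
    (a * M.+1 + b < a' * M.+1 + b')%N.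
  move=> aa' bM; apply: leq_trans (_ : a.+1 * M.+1 <= _)%N; first by rewrite mulSn; lia.
  by apply: leq_trans (leq_addr _ _); rewrite leq_mul2r aa' orbT.
case: (ltngtP (w q) (w p)) => [lt|gt|/val_inj E].
- by rewrite key_lt.
- rewrite [X in X || _](_ : _ = false); last by apply/negbTE; rewrite -leqNgt ltnW // key_lt.
  rewrite -(inj_eq val_inj) /= (gtn_eqF gt) /= andbC.
  rewrite [X in _ && X](_ : _ = false) ?andbF //; apply/eqP => E.
  have := congr1 (fun b : refined M => val b.1) E; rewrite /= /refine.
  by do 2![case: ifP => _ /=]; move: gt; lia.
rewrite E eqxx /= /refine /=; case: (ltngtP (w p) K) => wK /=.
- by rewrite ltnn eqxx.
- by rewrite ltnn eqxx.
- by rewrite ltn_add2l xpair_eqE eqxx.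
Qed.

(** A refined word arises from a letter and an independent uniform label at each position. Grouping
    the labels by pattern replaces the uniform [tau] of the shuffle by one distributed as
    [pattern_freq]. *)
Lemma refined_cycle_index M :
  \sum_(w : {ffun 'I_n -> 'I_(K.*2.+1)}) (\prod_p lp (w p)) *:
     \sum_tau pattern_freq R M tau *:
        cycle_monomial R (shuffle_perm (fun q => (w q)%:Z - K%:Z) tau) =
  (cycle_series n (super_psum (@refined_neg M) (@refined_weight M)))`_n.
Proof.
rewrite -(finite_cycle_index _ _ (@refined_key_inj M)).
rewrite -(@sum_words_pushforward R _ (refined M) (refined M) n (@refine M)
  (fun b => lp b.1 / M.+1%:R)
  (fun v => cycle_monomial R (std (@refined_neg M) (@refined_key_inj M) v))).
pose h (u : {ffun 'I_n -> 'I_(K.*2.+1)} * {ffun 'I_n -> 'I_M.+1}) :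
  {ffun 'I_n -> refined M} := [ffun k => (u.1 k, u.2 k)].
pose h' (v : {ffun 'I_n -> refined M}) := ([ffun k => (v k).1], [ffun k => (v k).2]).
have hK : cancel h h'.
  by move=> [w r]; rewrite /h /h'; congr (_, _); apply/ffunP => k; rewrite !ffunE.
have h'K : cancel h' h.
  by move=> v; apply/ffunP => k; rewrite !ffunE /=; case: (v k).
rewrite (reindex h) /=; last by exists h' => ? _; [apply: hK | apply: h'K].
rewrite -(pair_big xpredT xpredT (fun w r => (\prod_k (lp (h (w, r) k).1 / M.+1%:R)) *:
  cycle_monomial R (std (@refined_neg M) (@refined_key_inj M)
    [ffun k => refine (h (w, r) k)]))) /=.
apply: eq_bigr => w _.
rewrite [RHS](partition_big (fun r : {ffun 'I_n -> 'I_M.+1} => pattern r) xpredT) //=.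
rewrite scaler_sumr; apply: eq_bigr => tau _.
rewrite /pattern_freq -sum1dep_card natr_sum mulr_suml scaler_suml scaler_sumr.
apply: eq_bigr => r /eqP <-; rewrite scalerA; congr (_ *: cycle_monomial R _).
  under [in RHS]eq_bigr do rewrite ffunE.
  by rewrite big_split /= prodr_const card_ord mul1r exprVn.
rewrite -refined_std; apply: eq_rank_perm => q p.
by rewrite /std_lt !ffunE.
Qed.

Definition truncated_psum m : R :=
  (m == 1%N)%:R * gamma + series (fun k => alpha k ^+ m) K
  + (-1) ^+ m.+1 * series (fun k => beta k ^+ m) K.

Lemma sum_centered (F : nat -> R) :
  \sum_(a < K.*2.+1) F a = \sum_(i < K) F (K - i.+1)%N + F K + \sum_(i < K) F (K + i.+1)%N.
Proof.
rewrite -(big_mkord xpredT F) (@big_cat_nat _ _ _ K) //=; last by lia.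
rewrite [X in _ + X]big_ltn; last by lia.
rewrite addrA; congr (_ + _ + _).
  by rewrite big_nat_rev big_mkord.
rewrite -{1}(add0n K.+1) big_addn; have -> : (K.*2.+1 - K.+1 = K)%N by lia.
by rewrite big_mkord; apply: eq_bigr => i _; rewrite !addnS addnC.
Qed.

Local Open Scope classical_set_scope.

Lemma cvg_harmonicX k : (fun M => @harmonic R M ^+ k.+1) @ \oo --> (0 : R).
Proof.
elim: k => [|k IH]; first by under eq_fun do rewrite expr1; apply: cvg_harmonic.
under eq_fun do rewrite exprS.
by have := cvgM (@cvg_harmonic R) IH; rewrite mulr0; apply.
Qed.

(** The copies of [0] contribute [M.+1 * (gamma / M.+1) ^+ m], which is [gamma] for [m = 1] and
    tends to [0] otherwise; hence [gamma] occurs only in the first power sum. *)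
Lemma cvg_refined_psum m : (0 < m)%N ->
  (fun M => super_psum (@refined_neg M) (@refined_weight M) m) @ \oo --> truncated_psum m.
Proof.
move=> m0; pose F (a : nat) : R := ((-1) ^+ (a < K)%N) ^+ m.+1 *
  letter_prob alpha beta gamma (a%:Z - K%:Z) ^+ m.
have E M : super_psum (@refined_neg M) (@refined_weight M) m =
    \sum_(a < K.*2.+1) if a == K :> nat then gamma ^+ m * harmonic M ^+ m.-1 else F a.
  rewrite /super_psum -(pair_big xpredT xpredT (fun a r =>
     ((-1) ^+ @refined_neg M (a, r)) ^+ m.+1 * refined_weight (a, r) ^+ m)) /=.
  apply: eq_bigr => a _; under eq_bigr do rewrite refined_weightE /refined_neg /=.
  case: eqP => [aK|_].
    rewrite sumr_const card_ord aK ltnn expr0 expr1n mul1r exprMn -mulrnAr /harmonic /=.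
    by case: (m) m0 => // m' _; congr (_ * _);
      rewrite exprS -mulrnAl -mulr_natr mulVf ?mul1r ?pnatr_eq0.
  rewrite (bigD1 ord0) //= big1 ?addr0 // => r /negbTE->.
  by rewrite expr0n; case: (m) m0 => // m' _; rewrite mulr0.
have -> : truncated_psum m =
    \sum_(a < K.*2.+1) if a == K :> nat then (m == 1%N)%:R * gamma else F a.
  rewrite (sum_centered (fun a => if a == K then (m == 1%N)%:R * gamma else F a)) eqxx.
  rewrite /truncated_psum /series /= !big_mkord [X in _ = X + _]addrC [RHS]addrAC.
  congr (_ + _ + _).
    apply: eq_bigr => i _; rewrite ifN; last by lia.
    rewrite /F (_ : (K + i.+1 < K)%N = false); last by lia.
    rewrite expr0 expr1n mul1r /letter_prob.
    have -> : (K + i.+1)%N%:Z - K%:Z = i.+1 by lia.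
    by [].
  rewrite mulr_sumr; apply: eq_bigr => i _; have Hi := ltn_ord i.
  rewrite ifN; last by lia.
  rewrite /F (_ : (K - i.+1 < K)%N); last by lia.
  rewrite expr1 /letter_prob; have -> : (K - i.+1)%N%:Z - K%:Z = - (i.+1)%:Z by lia.
  by rewrite oppr_gt0 oppr_lt0 abszN.
under eq_fun do rewrite E.
apply: cvgr_sum => a _; case: eqP => _; last exact: cvg_cst.
case: (m) m0 => // -[_|m' _] /=.
  by under eq_fun do rewrite expr0 mulr1 expr1; rewrite mul1r; apply: cvg_cst.
rewrite mul0r -[X in _ --> X](mulr0 (gamma ^+ m'.+2)); apply: cvgM; first exact: cvg_cst.
exact: cvg_harmonicX.
Qed.

(** Let [M] tend to infinity in [refined_cycle_index]: the frequencies tend to [1 / n!] and the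
    power sums to [truncated_psum]. *)
Lemma truncated_cycle_index :
  \sum_(pi : 'S_n) shuffle_prob_trunc alpha beta gamma pi K *: cycle_monomial R pi =
  (cycle_series n truncated_psum)`_n.
Proof.
transitivity (\sum_(w : {ffun 'I_n -> 'I_(K.*2.+1)}) (\prod_p lp (w p)) *:
     \sum_tau (n`!%:R^-1 : R) *:
        cycle_monomial R (shuffle_perm (fun q => (w q)%:Z - K%:Z) tau)).
  under eq_bigr do rewrite /shuffle_prob_trunc scaler_suml.
  rewrite exchange_big; apply: eq_bigr => w _ /=.
  under eq_bigr do rewrite -scalerA.
  rewrite -scaler_sumr; congr (_ *: _).
  set w' := fun q : 'I_n => (w q)%:Z - K%:Z.
  rewrite [RHS](partition_big (shuffle_perm w') xpredT) //=; apply: eq_bigr => pi _.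
  rewrite card_shuffle_val -sum1dep_card natr_sum mulr_suml scaler_suml.
  by apply: eq_bigr => tau /eqP <-; rewrite mul1r.
apply: (@cvg_mpoly_unique R n (fun M =>
  (cycle_series n (super_psum (@refined_neg M) (@refined_weight M)))`_n)); last first.
  by apply: cvg_cycle_series => // m m0; apply: cvg_refined_psum.
under eq_fun do rewrite -refined_cycle_index.
apply: cvg_mpoly_sum => w _; apply: cvg_mpolyZ; first exact: cvg_cst.
apply: cvg_mpoly_sum => tau _; apply: cvg_mpolyZ; last exact: cvg_mpoly_cst.
exact: cvg_pattern_freq.
Qed.

End RefinedAlphabet.

(** * From letters in [[-K, K]] to all integers *)

Section InfiniteAlphabet.
Variables (R : realType) (alpha beta : nat -> R) (gamma : R) (n : nat).
Hypothesis gamma_ge0 : 0 <= gamma.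
Hypothesis alpha_ge0 : forall k, 0 <= alpha k.
Hypothesis beta_ge0 : forall k, 0 <= beta k.
Hypothesis cvg_alpha : cvgn (series alpha).
Hypothesis cvg_beta : cvgn (series beta).
Hypothesis total_mass : gamma + ssum alpha + ssum beta = 1.
Local Open Scope classical_set_scope.

Lemma series_ge0_le_ssum (a : nat -> R) K : (forall k, 0 <= a k) -> cvgn (series a) ->
  0 <= series a K <= ssum a.
Proof.
move=> a0 ca; rewrite /ssum; apply/andP; split; first by apply: sumr_ge0.
apply: nondecreasing_cvgn_le => //.
by apply: nondecreasing_series => k _ _; apply: a0.
Qed.

(** Each term is at most the total, hence at most [1], so its powers are dominated by the term
    itself. *)
Lemma cvg_series_expr (a : nat -> R) m : (forall k, 0 <= a k) -> cvgn (series a) ->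
  ssum a <= 1 -> (0 < m)%N -> series (fun k => a k ^+ m) @ \oo --> ssum (fun k => a k ^+ m).
Proof.
move=> a0 ca a1 m0; apply: (@series_le_cvg _ _ a) => // [k|k]; first exact: exprn_ge0.
have ak1 : a k <= 1.
  apply: le_trans a1; have /andP[_] := series_ge0_le_ssum k.+1 a0 ca.
  apply: le_trans; rewrite /series /= big_nat_recr //= lerDr.
  by apply: sumr_ge0.
by case: (m) m0 => // m' _; rewrite exprS ler_piMr // exprn_ile1.
Qed.

Lemma ssum_ge0 (a : nat -> R) : (forall k, 0 <= a k) -> cvgn (series a) -> 0 <= ssum a.
Proof.
by move=> a0 ca; have /andP[] := series_ge0_le_ssum 0 a0 ca; apply: le_trans.
Qed.

Lemma cvg_truncated_psum m : (0 < m)%N ->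
  (fun K => truncated_psum alpha beta gamma K m) @ \oo --> ptilde alpha beta gamma m.
Proof.
move=> m0; have A0 := ssum_ge0 alpha_ge0 cvg_alpha; have B0 := ssum_ge0 beta_ge0 cvg_beta.
have A1 : ssum alpha <= 1 by move: gamma_ge0 total_mass A0 B0; lra.
have B1 : ssum beta <= 1 by move: gamma_ge0 total_mass A0 B0; lra.
have -> : ptilde alpha beta gamma m = (m == 1%N)%:R * gamma + ssum (fun k => alpha k ^+ m)
   + (-1) ^+ m.+1 * ssum (fun k => beta k ^+ m).
  rewrite /ptilde; case: eqP => [->|_]; last by rewrite mul0r add0r.
  have E (a : nat -> R) : (fun k => a k ^+ 1) = a by apply/funext => k; rewrite expr1.
  by rewrite !E sqrrN expr1n !mul1r; ring.
apply: cvgD; first apply: cvgD; first exact: cvg_cst.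
- exact: cvg_series_expr.
- by apply: cvgM; [exact: cvg_cst | exact: cvg_series_expr].
Qed.

Lemma letter_prob_ge0 z : 0 <= letter_prob alpha beta gamma z.
Proof. by rewrite /letter_prob; do 2![case: ifP => _ //]. Qed.

(** The proportion of suitable [tau] is at most [1], and the words have total weight the [n]-th
    power of the mass of [[-K, K]]. *)
Lemma shuffle_prob_trunc_le1 (pi : 'S_n) K : shuffle_prob_trunc alpha beta gamma pi K <= 1.
Proof.
have f0 : (0 : R) < n`!%:R by rewrite ltr0n fact_gt0.
apply: le_trans (_ : \sum_(w : {ffun 'I_n -> 'I_(K.*2.+1)})
    \prod_(p < n) letter_prob alpha beta gamma ((w p)%:Z - K%:Z) <= _).
  apply: ler_sum => w _; rewrite ler_piMr ?prodr_ge0 // => [p _|].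
    exact: letter_prob_ge0.
  by rewrite ler_pdivrMr // mul1r ler_nat -card_Sn max_card.
rewrite -(bigA_distr_bigA (fun (_ : 'I_n) (a : 'I_(K.*2.+1)) =>
  letter_prob alpha beta gamma (a%:Z - K%:Z))) prodr_const /=.
apply: exprn_ile1.
  by apply: sumr_ge0 => a _; apply: letter_prob_ge0.
rewrite (sum_centered _ (fun a => letter_prob alpha beta gamma (a%:Z - K%:Z))).
have /andP[_ HA] := series_ge0_le_ssum K alpha_ge0 cvg_alpha.
have /andP[_ HB] := series_ge0_le_ssum K beta_ge0 cvg_beta.
have -> : \sum_(i < K) letter_prob alpha beta gamma ((K - i.+1)%N%:Z - K%:Z) = series beta K.
  rewrite /series /= big_mkord; apply: eq_bigr => i _; have Hi := ltn_ord i.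
  have -> : (K - i.+1)%N%:Z - K%:Z = - (i.+1)%:Z by lia.
  by rewrite /letter_prob oppr_gt0 oppr_lt0 abszN.
have -> : \sum_(i < K) letter_prob alpha beta gamma ((K + i.+1)%N%:Z - K%:Z) = series alpha K.
  rewrite /series /= big_mkord; apply: eq_bigr => i _.
  by have -> : (K + i.+1)%N%:Z - K%:Z = i.+1 by lia.
by rewrite subrr /letter_prob ltxx /= -total_mass; lra.
Qed.

Lemma shuffle_prob_trunc_mono (pi : 'S_n) :
  nondecreasing_seq (shuffle_prob_trunc alpha beta gamma pi).
Proof.
apply/nondecreasing_seqP => K; rewrite /shuffle_prob_trunc.
(* The shift by one compensates for the centre moving from [K] to [K.+1], so the letter itself is
   unchanged. *)
pose up (a : 'I_(K.*2.+1)) : 'I_(K.+1.*2.+1) := inord a.+1.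
have upE a : up a = a.+1 :> nat by rewrite inordK //; have := ltn_ord a; lia.
pose h (w : {ffun 'I_n -> 'I_(K.*2.+1)}) := [ffun p => up (w p)].
have hinj : injective h.
  move=> w w' /ffunP E; apply/ffunP => p; apply: val_inj.
  by have := congr1 val (E p); rewrite !ffunE /= !upE => -[].
have hE w p : (h w p)%:Z - K.+1%:Z = (w p)%:Z - K%:Z by rewrite ffunE upE; lia.
rewrite [X in _ <= X](bigID (mem (h @: [set: {ffun 'I_n -> 'I_(K.*2.+1)}]%SET))) /=.
rewrite [X in _ <= X + _]big_imset /=; last by move=> w w' _ _; apply: hinj.
rewrite -[X in X <= _]addr0 lerD //.
  rewrite le_eqVlt; apply/orP; left; apply/eqP; apply: eq_big => [w|w _]; first by rewrite inE.
  have -> : (fun q : 'I_n => (h w q)%:Z - K.+1%:Z) = (fun q : 'I_n => (w q)%:Z - K%:Z).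
    by apply/funext => q; rewrite hE.
  by congr (_ * _); apply: eq_bigr => p _; rewrite hE.
apply: sumr_ge0 => w _; apply: mulr_ge0; last by rewrite divr_ge0.
by apply: prodr_ge0 => p _; apply: letter_prob_ge0.
Qed.

(** Monotone and bounded, so the [limn] in [shuffle_prob] is a genuine limit. *)
Lemma cvg_shuffle_prob (pi : 'S_n) :
  shuffle_prob_trunc alpha beta gamma pi @ \oo --> shuffle_prob alpha beta gamma pi.
Proof.
apply: nondecreasing_is_cvgn; first exact: shuffle_prob_trunc_mono.
by exists 1 => _ [K _ <-]; apply: shuffle_prob_trunc_le1.
Qed.

(** Both sides are the limit, as [K] grows, of the two sides of [truncated_cycle_index]. *)
Lemma EcycE : Ecyc alpha beta gamma n = rhs_coef alpha beta gamma n.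
Proof.
apply: (@cvg_mpoly_unique R n (fun K => (cycle_series n (truncated_psum alpha beta gamma K))`_n)).
  under eq_fun do rewrite -truncated_cycle_index.
  apply: cvg_mpoly_sum => pi _; apply: cvg_mpolyZ; last exact: cvg_mpoly_cst.
  exact: cvg_shuffle_prob.
rewrite rhs_coefE; apply: cvg_cycle_series => // m m0.
exact: cvg_truncated_psum.
Qed.

End InfiniteAlphabet.

Theorem theorem7p2 (R : realType) (alpha beta : nat -> R) (gamma : R) :
  0 <= gamma ->
  (forall k, 0 <= alpha k) ->
  (forall k, 0 <= beta k) ->
  cvgn (series alpha) ->
  cvgn (series beta) ->
  gamma + ssum alpha + ssum beta = 1 ->
  (forall n : nat, Ecyc alpha beta gamma n = rhs_coef alpha beta gamma n) /\
  (forall n : nat, Ecyc_rev alpha beta gamma n = Ecyc beta alpha gamma n).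
Proof.
move=> gamma_ge0 alpha_ge0 beta_ge0 cvg_alpha cvg_beta total_mass.
by split=> n; [apply: EcycE | apply: Ecyc_revE].
Qed.
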